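(* Let $f$ be an irreducible element of $\mathbb{Z}[\mathbb{H}]$ which is not invertible in $\ell^1(\mathbb{H},\mathbb{R})$ and which has a formal inverse $f^\sharp\in\mathbb{R}^{\mathbb{H}}$. Furthermore, let $g\in\mathbb{Z}[\mathbb{H}]$ be a central element such that $g\notin\mathbb{Z}[\mathbb{H}]f$ and $g\cdot f^\sharp\in\ell^1(\mathbb{H},\mathbb{R})$. Let $\xi_g\colon\ell^\infty(\mathbb{H},\mathbb{Z})\to\mathbb{T}^{\mathbb{H}}$ be the map $$\xi_g(v)=\eta\bigl(v\cdot(g^*\cdot(f^\sharp)^* )\bigr).$$ Then the following holds. (1) $\xi_g$ is continuous in the weak$^*$-topology on closed, bounded subsets of $\ell^\infty(\mathbb{H},\mathbb{Z})$. (2) $\xi_g\bigl(\{0,\ldots,\|f\|_1-1\}^{\mathbb{H}}\bigr)=\xi_g\bigl(B^\infty_{\|f\|_1/2}\bigr)=\xi_g\bigl(\ell^\infty(\mathbb{H},\mathbb{Z})\bigr)=X_f$, where $B^\infty_K$ denotes the closed ball of radius $K$ in $\ell^\infty(\mathbb{H},\mathbb{Z})$.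
   Context: $\mathbb{H}$ is the discrete Heisenberg group of upper triangular unipotent integer $3\times3$ matrices. Products of elements of $\mathbb{Z}[\mathbb{H}]$, $\ell^1(\mathbb{H},\mathbb{R})$, $\ell^\infty(\mathbb{H},\mathbb{R})$, $\mathbb{R}^{\mathbb{H}}$ (when defined) are convolutions: $(v\cdot w)_{\delta}=\sum_\gamma v_\gamma w_{\gamma^{-1}\delta}$; $1$ is the identity of $\mathbb{Z}[\mathbb{H}]$. For a real-valued $h$ on $\mathbb{H}$, $(h^* )_\gamma=h_{\gamma^{-1}}$. $\ell^\infty(\mathbb{H},\mathbb{Z})$ is the group of bounded integer-valued functions on $\mathbb{H}$ with the supremum norm; $\|f\|_1=\sum_\gamma|f_\gamma|$. A formal inverse of $f$ is an element $f^\sharp\in\mathbb{R}^{\mathbb{H}}\smallsetminus\ell^1(\mathbb{H},\mathbb{R})$ with $f\cdot f^\sharp=f^\sharp\cdot f=1$. $\mathbb{T}=\mathbb{R}/\mathbb{Z}$, and $\eta\colon\ell^\infty(\mathbb{H},\mathbb{R})\to\mathbb{T}^{\mathbb{H}}$ is $\eta(w)_\gamma=w_\gamma\pmod1$. With $(\rho^\gamma x)_{\gamma'}=x_{\gamma'\gamma}$ on $\mathbb{T}^{\mathbb{H}}$ and $\rho^f=\sum_\gamma f_\gamma\rho^\gamma$, the group $X_f$ is $\ker\rho^f\subset\mathbb{T}^{\mathbb{H}}$, with the product topology. The weak$^*$-topology is that of $\ell^\infty$ as the dual of $\ell^1$. *)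

(* Defs.v *)
From HB Require Import structures.
From mathcomp Require Import all_boot all_order all_algebra.
From mathcomp Require Import finmap.
From mathcomp Require Import all_classical all_reals all_analysis.

Set Implicit Arguments.
Unset Strict Implicit.
Unset Printing Implicit Defensive.

Import Order.TTheory GRing.Theory Num.Theory.
Import numFieldNormedType.Exports.

Local Open Scope classical_set_scope.
Local Open Scope ring_scope.

Definition unitriangular (M : 'M[int]_3) : bool :=
  [forall i : 'I_3, forall j : 'I_3, (j <= i)%N ==> (M i j == (i == j)%:R)].

Definition heis : Type := {M : 'M[int]_3 | unitriangular M}.

HB.instance Definition _ := [isSub of heis for @sval _ unitriangular].
HB.instance Definition _ := [Choice of heis by <:].

Lemma unitriangularP (M : 'M[int]_3) :
  reflect (forall i j : 'I_3, (j <= i)%N -> M i j = (i == j)%:R)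
          (unitriangular M).
Proof.
apply: (iffP forallP) => [hM i j ji|hM i].
  by have /forallP/(_ j)/implyP/(_ ji)/eqP := hM i.
by apply/forallP => j; apply/implyP => ji; rewrite hM.
Qed.

Lemma unitriangular_mul (M N : 'M[int]_3) :
  unitriangular M -> unitriangular N -> unitriangular (M *m N).
Proof.
move=> /unitriangularP hM /unitriangularP hN; apply/unitriangularP => i j ji.
rewrite mxE (bigD1 i)//= hM// eqxx mul1r hN// big1 ?addr0// => k ki.
case: (leqP k i) => [ki'|ik]; first by rewrite hM// eq_sym (negPf ki) mul0r.
rewrite hN ?(leq_trans ji (ltnW ik))//.
have /negPf -> : k != j by rewrite neq_ltn (leq_ltn_trans ji ik) orbT.
by rewrite mulr0.
Qed.

Lemma unitriangular1 : unitriangular 1%:M.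
Proof. by apply/unitriangularP => i j _; rewrite mxE. Qed.

Lemma unitriangular_unit (M : 'M[int]_3) : unitriangular M -> M \in unitmx.
Proof.
move=> /unitriangularP hM; rewrite unitmxE -det_tr det_trig.
  by rewrite big1 ?unitr1// => i _; rewrite mxE hM// eqxx.
apply/is_trig_mxP => i j ij; rewrite mxE hM ?(ltnW ij)//.
by have /negPf -> : j != i by rewrite neq_ltn ij orbT.
Qed.

Lemma unitriangular_inv (M : 'M[int]_3) :
  unitriangular M -> unitriangular (invmx M).
Proof.
move=> hM; have uM := unitriangular_unit hM.
move: hM => /unitriangularP hM.
pose N := 1%:M - M.
have N0 (k l : 'I_3) : (l <= k)%N -> N k l = 0.
  by move=> lk; rewrite !mxE hM// subrr.
have N3 : N *m N *m N = 0.
  apply/matrixP => i j; rewrite !mxE big1// => k _.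
  case: (leqP j k) => [jk|kj]; first by rewrite (N0 k j)// mulr0.
  rewrite mxE big1 ?mul0r// => l _.
  case: (leqP k l) => [kl|lk]; first by rewrite (N0 l k)// mulr0.
  case: (leqP l i) => [li|il]; first by rewrite (N0 i l)// mul0r.
  have := ltn_ord j; rewrite ltnNge; case/negP.
  by rewrite (leq_trans _ kj)// ltnS (leq_trans _ lk)// ltnS (leq_trans _ il).
have ME : M = 1%:M - N by rewrite /N opprB addrC subrK.
clearbody N.
have MV : M *m (1%:M + N + N *m N) = 1%:M.
  rewrite {1}ME mulmxBl mul1mx !mulmxDr mulmx1 (mulmxA N N N) N3 addr0.
  by rewrite -(addrA 1%:M) addrK.
have -> : invmx M = 1%:M + N + N *m N.
  by rewrite -[RHS](mulKmx uM) MV mulmx1.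
have NN0 (i j : 'I_3) : (j <= i)%N -> (N *m N) i j = 0.
  move=> ji; rewrite mxE big1// => k _.
  case: (leqP k i) => [ki|ik]; first by rewrite N0// mul0r.
  by rewrite (N0 k j) ?mulr0// (leq_trans ji (ltnW ik)).
apply/unitriangularP => i j ji.
by rewrite mxE NN0// addr0 mxE N0// addr0 mxE.
Qed.

Definition heis_one : heis := exist unitriangular _ unitriangular1.
Definition heis_mul (a b : heis) : heis :=
  exist unitriangular _ (unitriangular_mul (svalP a) (svalP b)).
Definition heis_inv (a : heis) : heis :=
  exist unitriangular _ (unitriangular_inv (svalP a)).

Lemma heis_mulA : associative heis_mul.
Proof. by move=> a b c; apply/val_inj; rewrite /= mulmxA. Qed.
Lemma heis_mul1g : left_id heis_one heis_mul.
Proof. by move=> a; apply/val_inj; rewrite /= mul1mx. Qed.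
Lemma heis_mulg1 : right_id heis_one heis_mul.
Proof. by move=> a; apply/val_inj; rewrite /= mulmx1. Qed.
Lemma heis_mulVg : left_inverse heis_one heis_inv heis_mul.
Proof.
move=> a; apply/val_inj; rewrite /= mulVmx//.
exact: unitriangular_unit (svalP a).
Qed.
Lemma heis_mulgV : right_inverse heis_one heis_inv heis_mul.
Proof.
move=> a; apply/val_inj; rewrite /= mulmxV//.
exact: unitriangular_unit (svalP a).
Qed.

HB.instance Definition _ := isGroup.Build heis
  heis_mulA heis_mul1g heis_mulg1 heis_mulVg heis_mulgV.

Definition zheis : Type := {fsfun heis -> int with 0}.
Identity Coercion fsfun_of_zheis : zheis >-> fsfun.

Definition zheis_one : zheis := [fsfun c in [fset 1%g]%fset => 1 | 0].

Definition zheis_mul (a b : zheis) : zheis :=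
  [fsfun d in [fset (c * e)%g | c in finsupp a, e in finsupp b]%fset =>
     \sum_(c <- finsupp a) a c * b (c^-1 * d)%g | 0].

Lemma zheis_mulE (a b : zheis) (d : heis) :
  zheis_mul a b d = \sum_(c <- finsupp a) a c * b (c^-1 * d)%g.
Proof.
rewrite fsfunE; case: ifPn => // dab; rewrite big_seq big1// => c ca.
have [bcd|bcd] := boolP ((c^-1 * d)%g \in finsupp b); last first.
  by rewrite (fsfun_dflt bcd) mulr0.
by case/negP: dab; apply/imfset2P; exists c => //; exists (c^-1 * d)%g;
  rewrite ?mulVKg.
Qed.

Definition zheis_unit (a : zheis) : Prop :=
  exists b : zheis, zheis_mul a b = zheis_one /\ zheis_mul b a = zheis_one.

Definition zheis_irreducible (a : zheis) : Prop :=
  ~ zheis_unit a /\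
  forall b c : zheis, a = zheis_mul b c -> zheis_unit b \/ zheis_unit c.

Definition zheis_central (a : zheis) : Prop :=
  forall b : zheis, zheis_mul a b = zheis_mul b a.

Definition zheis_norm1 (a : zheis) : int := \sum_(c <- finsupp a) `|a c|.

Section RealFunctions.
Variable R : realType.
Implicit Types (u v w : heis -> R) (a : zheis).

Definition real_of_zheis a : heis -> R := fun c => (a c)%:~R.

Definition ell1 : set (heis -> R) :=
  [set u | summable [set: heis] (EFin \o u)].

(* The value is meaningful when [u] is absolutely summable, which is the case
   wherever it is used below: there, each family is either finitely supported
   or the product of a bounded and of an absolutely summable family. *)
Definition heis_sum u : R :=
  fine (\esum_(c in [set: heis]) (EFin \o u)^\+ c -
        \esum_(c in [set: heis]) (EFin \o u)^\- c)%E.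

Definition convol v w : heis -> R :=
  fun d => heis_sum (fun c => v c * w (c^-1 * d)%g).

Definition heis_delta : heis -> R := fun c => (c == 1%g)%:R.

Definition star u : heis -> R := fun c => u (c^-1)%g.

Definition ell1_invertible u : Prop :=
  exists2 w, ell1 w & convol u w = heis_delta /\ convol w u = heis_delta.

Definition formal_inverse a w : Prop :=
  [/\ ~ ell1 w, convol (real_of_zheis a) w = heis_delta
     & convol w (real_of_zheis a) = heis_delta].

End RealFunctions.

Definition bounded_zfun : set (heis -> int) :=
  [set v | exists K : int, forall c, `|v c| <= K].

Definition linfZ : Type := bounded_zfun.
HB.instance Definition _ := Choice.on linfZ.

Definition linfZ_fun (v : linfZ) : heis -> int := val v.
Coercion linfZ_fun : linfZ >-> Funclass.

Section Topologies.
Variable R : realType.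

Definition real_of_linfZ (v : linfZ) : heis -> R := fun c => (v c)%:~R.

Definition linf_norm (v : linfZ) : R :=
  sup (range (fun c => `|real_of_linfZ v c|)).

Definition linf_ball (K : R) : set linfZ := [set v | linf_norm v <= K].

Definition linf_bounded (C : set linfZ) : Prop :=
  exists K : R, C `<=` linf_ball K.

(* The metric topology of the supremum norm is that of uniform convergence.
   Distinct integer-valued functions are at distance at least 1, so that a
   weak*-closed subset of ell^oo(H, Z) is in particular closed here. *)
Definition linf_uniform : Type :=
  initial_topology (real_of_linfZ : linfZ -> {uniform heis -> R}).
HB.instance Definition _ := Topological.on linf_uniform.

(* The topology that ell^oo(H, Z) inherits from the weak* topology of
   ell^oo(H, R): the coarsest one making the pairing with each element of
   ell^1(H, R) continuous. *)
Definition weakstar_pairing (v : linfZ) : {ptws @ell1 R -> R} :=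
  fun u => heis_sum (fun c => real_of_linfZ v c * val u c).

Definition linf_weakstar : Type := initial_topology weakstar_pairing.
HB.instance Definition _ := Topological.on linf_weakstar.

Definition integers : zmodClosed R :=
  GRing.ZmodClosed.clone R (@Num.int_num_subdef R : {pred R}) _.

Lemma integersE (t : R) : (t \in integers) = (t \is a Num.int).
Proof. by []. Qed.

Definition torus : Type :=
  quotient_topology (Quotient.quot integers).
HB.instance Definition _ := Topological.on torus.
HB.instance Definition _ := GRing.Zmodule.copy torus
  (Quotient.quot integers).

Definition to_torus (t : R) : torus :=
  \pi_(Quotient.quot integers)%qT t.

Definition eta (w : heis -> R) : heis -> torus := fun c => to_torus (w c).

Definition rho_shift (c : heis) (x : heis -> torus) : heis -> torus :=
  fun d => x (d * c)%g.

Definition rho (f : zheis) (x : heis -> torus) : heis -> torus :=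
  fun d => \sum_(c <- finsupp f) rho_shift c x d *~ f c.

Definition X_ (f : zheis) : set (heis -> torus) :=
  [set x | forall d, rho f x d = 0].

Definition xi (g : zheis) (fsharp : heis -> R) (v : linfZ) : heis -> torus :=
  eta (convol (real_of_linfZ v) (convol (star (real_of_zheis R g)) (star fsharp))).

End Topologies.

Arguments X_ : clear implicits.

(* Main.v *)
(* Put [w = g f^#], which is summable, and satisfies [f w = w f = g] because [g]
   is central; then [xi v = eta (v w^* )], and [rho f (xi v) = eta (v g^* ) = 0].
   Conversely, if [u] is a bounded real lift of [y] in [X_f], then [v = u f^*]
   is integral and [xi v = eta (u f^* w^* ) = eta (u g^* ) = rho g y].  So
   everything rests on the surjectivity of [rho g] on [X_f]; lifts in
   [-1/2, 1/2] and in [0, 1), the latter after subtracting [xi] of a constant,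
   give the two bounded sets of preimages.

   By divisibility of [R/Z], [rho g] is onto as soon as multiplication by [g] is
   injective on the left module [Z[H] / Z[H] f].  A central [g] is a Laurent
   polynomial in the central generator, so up to a unit a product of primes of
   [Z[X]], and these stay completely prime in [Z[H]], an iterated skew Laurent
   extension with ordered exponent group Z^2.  If a prime [p] divides [k f], then
   it divides [k] and cancels, or it divides [f], and irreducibility makes [p]
   either a unit or a generator of [Z[H] f], the latter excluded by
   [g \notin Z[H] f].

   Continuity is immediate coordinatewise, since [(v w^* )_d] is the pairing of
   [v] with a translate of [w^*]. *)

From HB Require Import structures.
Require Import Defs.
From mathcomp Require Import all_boot all_order all_algebra.
From mathcomp Require Import finmap zify lra.
From mathcomp Require Import all_classical all_reals all_analysis.

Set Implicit Arguments.
Unset Strict Implicit.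
Unset Printing Implicit Defensive.

Import Order.TTheory GRing.Theory Num.Theory.
Import numFieldNormedType.Exports.

Local Open Scope classical_set_scope.
Local Open Scope ring_scope.

(** * The integral group ring *)

HB.instance Definition _ := Choice.on zheis.

Lemma zheisP (a b : zheis) : a =1 b <-> a = b.
Proof. exact: fsfunP. Qed.

Definition zheis_add (a b : zheis) : zheis :=
  [fsfun c in (finsupp a `|` finsupp b)%fset => a c + b c | 0].
Definition zheis_opp (a : zheis) : zheis :=
  [fsfun c in finsupp a => - a c | 0].
Definition zheis_zero : zheis := [fsfun with 0].

Lemma zheis_addE a b c : zheis_add a b c = a c + b c.
Proof.
rewrite fsfunE; case: ifPn => //; rewrite inE negb_or => /andP[ha hb].
by rewrite (fsfun_dflt ha) (fsfun_dflt hb) addr0.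
Qed.

Lemma zheis_oppE a c : zheis_opp a c = - a c.
Proof.
by rewrite fsfunE; case: ifPn => // ha; rewrite (fsfun_dflt ha) oppr0.
Qed.

Lemma zheis_zeroE c : zheis_zero c = 0.
Proof. by rewrite fsfunE. Qed.

Lemma zheis_addA : associative zheis_add.
Proof. by move=> a b c; apply/zheisP => d; rewrite !zheis_addE addrA. Qed.
Lemma zheis_addC : commutative zheis_add.
Proof. by move=> a b; apply/zheisP => d; rewrite !zheis_addE addrC. Qed.
Lemma zheis_add0 : left_id zheis_zero zheis_add.
Proof. by move=> a; apply/zheisP => d; rewrite zheis_addE zheis_zeroE add0r. Qed.
Lemma zheis_addN : left_inverse zheis_zero zheis_opp zheis_add.
Proof.
by move=> a; apply/zheisP => d; rewrite zheis_addE zheis_oppE zheis_zeroE addNr.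
Qed.

HB.instance Definition _ := GRing.isZmodule.Build zheis
  zheis_addA zheis_addC zheis_add0 zheis_addN.

(* The pairing [\sum_c h_c x_c]: the left and right actions of [zheis] on
   functions and its own product are all instances of it. *)
Definition pairing (V : zmodType) (h : zheis) (x : heis -> V) : V :=
  \sum_(c <- finsupp h) x c *~ h c.

Section Pairing.
Variable V : zmodType.
Implicit Types (a b h : zheis) (x y : heis -> V).

Lemma pairing_sub (S : {fset heis}) h x : (finsupp h `<=` S)%fset ->
  pairing h x = \sum_(c <- S) x c *~ h c.
Proof.
move=> hS; rewrite /pairing (big_fset_incl _ hS)//= => c _ ch.
by rewrite (fsfun_dflt ch) mulr0z.
Qed.

Lemma eq_pairing h x y : x =1 y -> pairing h x = pairing h y.
Proof. by move=> xy; apply: eq_bigr => c _; rewrite xy. Qed.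

Lemma pairing0l x : pairing 0 x = 0.
Proof.
by rewrite /pairing big1 // => c _; rewrite zheis_zeroE mulr0z.
Qed.

Lemma pairingDl a b x : pairing (a + b) x = pairing a x + pairing b x.
Proof.
pose S := (finsupp a `|` finsupp b `|` finsupp (a + b)%R)%fset.
have aS : (finsupp a `<=` S)%fset by rewrite /S -fsetUA fsubsetUl.
have bS : (finsupp b `<=` S)%fset.
  by rewrite /S (fsetUC (finsupp a)) -fsetUA fsubsetUl.
have abS : (finsupp (a + b)%R `<=` S)%fset by rewrite /S fsubsetUr.
rewrite (pairing_sub x aS) (pairing_sub x bS) (pairing_sub x abS) -big_split/=.
by apply: eq_bigr => c _; rewrite zheis_addE mulrzDr.
Qed.

Lemma pairingNl a x : pairing (- a) x = - pairing a x.
Proof.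
by apply/eqP; rewrite -subr_eq0 opprK -pairingDl addNr pairing0l.
Qed.

Lemma pairingDr a x y :
  pairing a (fun c => x c + y c) = pairing a x + pairing a y.
Proof. by rewrite -big_split/=; apply: eq_bigr => c _; rewrite mulrzDl. Qed.

Lemma pairingNr a x : pairing a (fun c => - x c) = - pairing a x.
Proof. by rewrite -sumrN; apply: eq_bigr => c _; rewrite mulNrz. Qed.

Lemma pairing_exchange a b (F : heis -> heis -> V) :
  pairing a (fun c => pairing b (F c)) =
  pairing b (fun e => pairing a (fun c => F c e)).
Proof.
rewrite /pairing.
under eq_bigr do rewrite mulrz_suml.
rewrite exchange_big/=; apply: eq_bigr => e _.
by rewrite mulrz_suml; apply: eq_bigr => c _; rewrite mulrzAC.
Qed.

End Pairing.

Lemma zheis_mul_pairing a b d :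
  zheis_mul a b d = pairing a (fun c => b (c^-1 * d)%g).
Proof.
rewrite zheis_mulE; apply: eq_bigr => c _.
by rewrite -mulrzr intz mulrC.
Qed.

Lemma raddf_pairing (U V : zmodType) (phi : {additive U -> V}) h x :
  phi (pairing h x) = pairing h (phi \o x).
Proof. by rewrite raddf_sum; apply: eq_bigr => c _; rewrite raddfMz. Qed.

Definition delta (c : heis) : zheis := [fsfun e in [fset c]%fset => 1 | 0].

Lemma deltaE c d : delta c d = (d == c)%:R.
Proof. by rewrite fsfunE inE; case: eqP. Qed.

Lemma pairing_delta (V : zmodType) c (x : heis -> V) : pairing (delta c) x = x c.
Proof.
rewrite (@pairing_sub _ [fset c]%fset) ?big_seq_fset1 ?deltaE ?eqxx//.
by apply/fsubsetP => e; rewrite mem_finsupp deltaE in_fset1; case: (e == c).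
Qed.

Lemma pairing_transl (V : zmodType) (b : zheis) c (x : heis -> V)
    (S : {fset heis}) :
  (forall j, j \in finsupp b -> (c * j)%g \in S) ->
  pairing b (fun j => x (c * j)%g) = \sum_(d <- S) x d *~ b (c^-1 * d)%g.
Proof.
move=> hS.
rewrite (@pairing_sub _ [fset (c^-1 * d)%g | d in S]%fset).
  rewrite big_imfset/=; first by apply: eq_bigr => d _; rewrite mulVKg.
  by move=> d e _ _ /mulgI.
apply/fsubsetP => j /hS cj; apply/imfsetP; exists (c * j)%g => //=.
by rewrite mulKg.
Qed.

(** Group the pairs [(c, e)] by their product. Functions on the group thereby become a module over
    the ring, and associativity of [zheis_mul] is the instance where [x] is built from a third ring
    element. *)
Lemma pairing_mul (V : zmodType) a b (x : heis -> V) :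
  pairing (zheis_mul a b) x =
  pairing a (fun c => pairing b (fun e => x (c * e)%g)).
Proof.
pose S := [fset (c * e)%g | c in finsupp a, e in finsupp b]%fset.
rewrite (@pairing_sub _ S); last first.
  apply/fsubsetP => d; rewrite mem_finsupp zheis_mulE; apply: contraNT => dS.
  rewrite big_seq big1// => c ca.
  have [bcd|bcd] := boolP ((c^-1 * d)%g \in finsupp b).
    by case/imfset2P: dS; exists c => //; exists (c^-1 * d)%g; rewrite ?mulVKg.
  by rewrite (fsfun_dflt bcd) mulr0.
under eq_bigr do rewrite zheis_mulE mulrz_sumr.
rewrite exchange_big/= /pairing; apply: eq_big_seq => c ca.
have -> : \sum_(e <- finsupp b) x (c * e)%g *~ b e =
    \sum_(d <- S) x d *~ b (c^-1 * d)%g.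
  apply: pairing_transl => j jb; apply/imfset2P; by exists c => //; exists j.
rewrite mulrz_suml; apply: eq_bigr => d _.
by rewrite -mulrzA mulrC.
Qed.

Lemma zheis_mulA : associative zheis_mul.
Proof.
move=> a b c; apply/zheisP => d; rewrite !zheis_mul_pairing pairing_mul.
apply: eq_pairing => i; rewrite zheis_mul_pairing; apply: eq_pairing => j.
by rewrite invgM mulgA.
Qed.

Lemma zheis_oneE d : zheis_one d = (d == 1%g)%:R.
Proof. exact: deltaE. Qed.

Lemma zheis_mul1 : left_id zheis_one zheis_mul.
Proof.
move=> a; apply/zheisP => d.
by rewrite zheis_mul_pairing pairing_delta invg1 mul1g.
Qed.

Lemma heis_eqVM (c d : heis) : ((c^-1 * d)%g == 1%g) = (c == d).
Proof. by rewrite -(inj_eq (mulgI c)) mulVKg mulg1 eq_sym. Qed.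

Lemma zheis_mulr1 : right_id zheis_one zheis_mul.
Proof.
move=> a; apply/zheisP => d; rewrite zheis_mul_pairing.
have [da|da] := boolP (d \in finsupp a); last first.
  rewrite /pairing big_seq big1 ?(fsfun_dflt da)// => c ca.
  rewrite zheis_oneE heis_eqVM; case: eqP => [cd|_]; last exact: mul0rz.
  by rewrite -cd ca in da.
rewrite /pairing (big_fsetD1 d da) /= mulVg zheis_oneE eqxx big_seq big1 ?addr0.
  by rewrite intz.
move=> c; rewrite !inE => /andP[/negPf cd _].
by rewrite zheis_oneE heis_eqVM cd mul0rz.
Qed.

Lemma zheis_mulDl : left_distributive zheis_mul zheis_add.
Proof.
move=> a b c; apply/zheisP => d.
by rewrite zheis_addE !zheis_mul_pairing -pairingDl.
Qed.

Lemma zheis_mulDr : right_distributive zheis_mul zheis_add.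
Proof.
move=> a b c; apply/zheisP => d; rewrite zheis_addE !zheis_mul_pairing.
by rewrite -pairingDr; apply: eq_pairing => e; rewrite zheis_addE.
Qed.

Lemma zheis_one_neq0 : zheis_one != 0 :> zheis.
Proof.
apply/eqP => /zheisP/(_ 1%g); rewrite zheis_oneE eqxx.
by rewrite [RHS]zheis_zeroE.
Qed.

HB.instance Definition _ := GRing.Zmodule_isNzRing.Build zheis
  zheis_mulA zheis_mul1 zheis_mulr1 zheis_mulDl zheis_mulDr zheis_one_neq0.

Lemma zheisD (a b : zheis) c : (a + b) c = a c + b c.
Proof. exact: zheis_addE. Qed.
Lemma zheisN (a : zheis) c : (- a) c = - a c.
Proof. exact: zheis_oppE. Qed.
Lemma zheis0 c : (0 : zheis) c = 0.
Proof. exact: zheis_zeroE. Qed.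
Lemma zheisM (a b : zheis) d : (a * b) d = pairing a (fun c => b (c^-1 * d)%g).
Proof. exact: zheis_mul_pairing. Qed.

Lemma zheis_sum I (r : seq I) (P : pred I) (F : I -> zheis) c :
  (\sum_(i <- r | P i) F i) c = \sum_(i <- r | P i) F i c.
Proof. by elim/big_rec2: _ => [|i y1 y2 _ <-]; rewrite ?zheis0 ?zheisD. Qed.

Lemma zheisMz (a : zheis) (n : int) c : (a *~ n) c = a c * n.
Proof.
have pos (m : nat) : (a *+ m) c = a c * m%:Z.
  elim: m => [|m IH]; first by rewrite mulr0n zheis0 mulr0.
  by rewrite mulrSr zheisD IH -addn1 PoszD mulrDr mulr1.
case: n => m; first exact: pos.
by rewrite NegzE mulrNz zheisN -pmulrn pos mulrN.
Qed.

Lemma pairingM (V : zmodType) (a b : zheis) (x : heis -> V) :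
  pairing (a * b) x = pairing a (fun c => pairing b (fun e => x (c * e)%g)).
Proof. exact: pairing_mul. Qed.

Lemma zheis_sum_delta (a : zheis) : a = pairing a delta.
Proof.
apply/zheisP => d; rewrite zheis_sum.
have [da|da] := boolP (d \in finsupp a); last first.
  rewrite (fsfun_dflt da) big_seq big1// => c ca; rewrite zheisMz deltaE.
  by case: eqP => [dc|_]; rewrite ?mul0r// dc ca in da *.
rewrite (big_fsetD1 d da) /= zheisMz deltaE eqxx mul1r big_seq big1.
  by rewrite addr0.
move=> c.
by rewrite !inE zheisMz deltaE eq_sym => /andP[/negPf -> _]; rewrite mul0r.
Qed.

Lemma deltaM c d : delta c * delta d = delta (c * d)%g.
Proof.
apply/zheisP => e; rewrite zheisM pairing_delta !deltaE.
by rewrite -(inj_eq (mulgI c)) mulVKg.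
Qed.

Lemma delta1 : delta 1%g = 1.
Proof. by []. Qed.

Lemma zheisM_delta (a : zheis) c d : (a * delta c) d = a (d * c^-1)%g.
Proof.
transitivity ((a * 1) (d * c^-1)%g); last by rewrite mulr1.
rewrite !zheisM; apply: eq_pairing => e; rewrite deltaE zheis_oneE mulgA.
by rewrite -(inj_eq (mulIg c) _ 1%g) mulgVK mul1g.
Qed.

Lemma zheis_delta_M (a : zheis) c d : (delta c * a) d = a (c^-1 * d)%g.
Proof. by rewrite zheisM pairing_delta. Qed.

(** * Fibres of the group ring over Z^2 *)

(** The index [1 + 1] is the last one of ['I_3]: [hx] and [hy] sit on the superdiagonal, [hz] in the
    corner. *)
Definition hx (c : heis) : int := val c 0 1.
Definition hy (c : heis) : int := val c 1 (1 + 1).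
Definition hz (c : heis) : int := val c 0 (1 + 1).

Lemma ord3E (i : 'I_3) : [|| i == 0, i == 1 | i == 1 + 1].
Proof. by case: i => [[|[|[|m]]] i3]. Qed.

Lemma heisE (c d : heis) : hx c = hx d -> hy c = hy d -> hz c = hz d -> c = d.
Proof.
move=> ex ey ez; apply/val_inj/matrixP => i j.
have /unitriangularP hc := valP c; have /unitriangularP hd := valP d.
have [ji|] := leqP j i; first by rewrite hc// hd.
have := ord3E i; have := ord3E j.
by move=> /or3P[] /eqP -> /or3P[] /eqP ->.
Qed.

Lemma hx1 : hx 1%g = 0.
Proof. by rewrite /hx mxE. Qed.
Lemma hy1 : hy 1%g = 0.
Proof. by rewrite /hy mxE. Qed.
Lemma hz1 : hz 1%g = 0.
Proof. by rewrite /hz mxE. Qed.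

Lemma heis_mulE (c d : heis) (i j : 'I_3) : val (c * d)%g i j =
  val c i 0 * val d 0 j + val c i 1 * val d 1 j +
  val c i (1 + 1) * val d (1 + 1) j.
Proof.
rewrite mxE !big_ord_recr big_ord0 /= add0r.
have -> : widen_ord (leqnSn 2) (widen_ord (leqnSn 1) ord_max) = 0.
  exact/val_inj.
have -> : widen_ord (leqnSn 2) ord_max = 1 by exact/val_inj.
by have -> : ord_max = 1 + 1 :> 'I_3 by exact/val_inj.
Qed.

Lemma hxM c d : hx (c * d)%g = hx c + hx d.
Proof.
have /unitriangularP hc := valP c; have /unitriangularP hd := valP d.
rewrite /hx heis_mulE (hc 0 0)// (hd 1 1)// (hd (1 + 1) 1)//=.
by rewrite mulr0 addr0 mul1r mulr1 addrC.
Qed.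

Lemma hyM c d : hy (c * d)%g = hy c + hy d.
Proof.
have /unitriangularP hc := valP c; have /unitriangularP hd := valP d.
rewrite /hy heis_mulE (hc 1 0)// (hc 1 1)// (hd (1 + 1) (1 + 1))//=.
by rewrite mul0r add0r mul1r mulr1 addrC.
Qed.

Lemma hzM c d : hz (c * d)%g = hz c + hz d + hx c * hy d.
Proof.
have /unitriangularP hc := valP c; have /unitriangularP hd := valP d.
rewrite /hz /hx /hy heis_mulE (hc 0 0)// (hd (1 + 1) (1 + 1))//= mul1r mulr1.
by rewrite addrAC (addrC (val d _ _)).
Qed.

Lemma hxV c : hx c^-1%g = - hx c.
Proof. by apply/eqP; rewrite -addr_eq0 -hxM mulVg hx1. Qed.

Lemma hyV c : hy c^-1%g = - hy c.
Proof. by apply/eqP; rewrite -addr_eq0 -hyM mulVg hy1. Qed.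

Definition heis_mx (a b c : int) : 'M[int]_3 :=
  \matrix_(i < 3, j < 3)
    if i == j then 1 else if (i == 0) && (j == 1) then a
    else if (i == 1) && (j == 1 + 1) then b
    else if (i == 0) && (j == 1 + 1) then c else 0.

Lemma heis_mx_unitriangular a b c : unitriangular (heis_mx a b c).
Proof.
apply/unitriangularP => i j; rewrite mxE.
by have /or3P[] := ord3E i => /eqP ->; have /or3P[] := ord3E j => /eqP ->.
Qed.

Definition hmk a b c : heis := exist unitriangular _ (heis_mx_unitriangular a b c).

Lemma hx_mk a b c : hx (hmk a b c) = a.
Proof. by rewrite /hx mxE. Qed.
Lemma hy_mk a b c : hy (hmk a b c) = b.
Proof. by rewrite /hy mxE. Qed.
Lemma hz_mk a b c : hz (hmk a b c) = c.
Proof. by rewrite /hz mxE. Qed.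

Definition heis_coordE := (hx_mk, hy_mk, hz_mk, hx1, hy1, hz1, hxM, hyM, hzM).

Lemma hmk_central (n : int) (c : heis) : (hmk 0 0 n * c = c * hmk 0 0 n)%g.
Proof. by apply: heisE; rewrite !heis_coordE; lia. Qed.

Lemma delta_central n (a : zheis) :
  delta (hmk 0 0 n) * a = a * delta (hmk 0 0 n).
Proof.
apply/zheisP => d; rewrite zheis_delta_M zheisM_delta.
have -> : ((hmk 0 0 n)^-1 = hmk 0 0 (- n))%g.
  by apply/eqP; rewrite -heis_eqVM invgK; apply/eqP/heisE; rewrite !heis_coordE; lia.
by rewrite hmk_central.
Qed.

Definition zeta : zheis := delta (hmk 0 0 1).

Lemma zetaX n : zeta ^+ n = delta (hmk 0 0 n%:Z).
Proof.
elim: n => [|n IH]; last rewrite exprS IH deltaM.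
  by rewrite expr0 -delta1; congr delta; apply: heisE; rewrite !heis_coordE.
by congr delta; apply: heisE; rewrite !heis_coordE; lia.
Qed.

Lemma zeta_comm : commr_rmorph (intr : int -> zheis) zeta.
Proof. by move=> n; apply: commr_int. Qed.

(** Evaluation at the generator of the centre. Ordinary polynomials stand in for Laurent ones:
    [zeta] is invertible, so negative exponents are moved into a separate factor [delta]. *)
Definition iota : {poly int} -> zheis := horner_morph zeta_comm.
HB.instance Definition _ := GRing.RMorphism.on iota.

Lemma iotaE P : iota P = \sum_(i < size P) delta (hmk 0 0 i%:Z) *~ P`_i.
Proof.
rewrite /iota /horner_morph (@horner_coef_wide _ (size P)) ?size_poly//.
by apply: eq_bigr => i _; rewrite coef_map/= zetaX mulrzl.
Qed.

Lemma iota_eval P d : iota P d =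
  if [&& hx d == 0, hy d == 0 & 0 <= hz d] then P`_(`|hz d|%N) else 0.
Proof.
rewrite iotaE zheis_sum; under eq_bigr do rewrite zheisMz deltaE.
case: ifPn => [/and3P[/eqP dx /eqP dy dz]|hd]; last first.
  rewrite big1// => i _; case: eqP => [di|_]; last by rewrite mul0r.
  by move: hd; rewrite di !heis_coordE !eqxx.
have dE : d = hmk 0 0 `|hz d|%N by apply: heisE; rewrite !heis_coordE// gez0_abs.
have [lt|ge] := ltnP `|hz d|%N (size P); last first.
  rewrite nth_default// big1// => i _; case: eqP => [di|_]; last by rewrite mul0r.
  by move: ge; rewrite di !heis_coordE /= leqNgt ltn_ord.
rewrite (bigD1 (Ordinal lt))//= {1}dE eqxx mul1r big1 ?addr0// => i /eqP/val_eqP/= il.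
case: eqP => [di|_]; last by rewrite mul0r.
by move: il; rewrite {1}di !heis_coordE eqxx.
Qed.

Lemma iota_inj : injective iota.
Proof.
move=> P Q PQ; apply/polyP => i.
have := congr1 (fun a : zheis => a (hmk 0 0 i%:Z)) PQ.
by rewrite /= !iota_eval !heis_coordE !eqxx.
Qed.

Lemma iota_comm P (a : zheis) : iota P * a = a * iota P.
Proof.
rewrite iotaE mulr_suml mulr_sumr; apply: eq_bigr => i _.
by rewrite mulrzAl mulrzAr delta_central.
Qed.

Definition slope (c : heis) : int * int := (hx c, hy c).

(* [slope] is the quotient map of the Heisenberg group by its centre, so an
   element of the group ring supported on one fibre is a Laurent polynomial in
   [zeta] times a group element. *)
Definition fibred (q : int * int) (a : zheis) : Prop :=
  forall c, slope c != q -> a c = 0.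

Definition fibre (q : int * int) (a : zheis) : zheis :=
  [fsfun c in finsupp a => if slope c == q then a c else 0 | 0].

Lemma fibreE q a c : fibre q a c = if slope c == q then a c else 0.
Proof.
by rewrite fsfunE; case: ifPn => // /fsfun_dflt ->; rewrite if_same.
Qed.

Lemma fibre_fibred q a : fibred q (fibre q a).
Proof. by move=> c /negPf cq; rewrite fibreE cq. Qed.

Lemma hz_bounded (a : zheis) :
  exists N : nat, forall c, a c != 0 -> (`|hz c| <= N)%N.
Proof.
exists (\max_(c <- finsupp a) `|hz c|%N)%N => c ac.
by apply: (@leq_bigmax_seq _ _ xpredT (fun c => `|hz c|%N)); rewrite ?mem_finsupp.
Qed.

Lemma fibredP q a : fibred q a ->
  exists Q n, a = iota Q * delta (hmk q.1 q.2 n).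
Proof.
move=> aq; have [N hN] := hz_bounded a.
(* [N] bounds the absolute value of [hz] on the support, so after a shift by [N] all exponents lie
   between 0 and 2N. *)
exists (\poly_(i < N.*2.+1) a (hmk q.1 q.2 (i%:Z - N%:Z))), (- N%:Z).
apply/zheisP => d; rewrite zheisM_delta.
set g := hmk _ _ _; set e := (_ * _)%g.
have dE : d = (e * g)%g by rewrite /e mulgVK.
clearbody e; rewrite {d}dE iota_eval coef_poly.
have [eq|] := eqVneq (slope (e * g)%g) q; last first.
  move=> neq; rewrite aq//; case: ifP => // /and3P[/eqP ex /eqP ey _].
  by move: neq; rewrite /slope /g !heis_coordE ex ey !add0r -surjective_pairing eqxx.
have ex : hx e = 0.
  by move: eq; rewrite /slope /g !heis_coordE => /(congr1 fst)/=; lia.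
have ey : hy e = 0.
  by move: eq; rewrite /slope /g !heis_coordE => /(congr1 snd)/=; lia.
rewrite ex ey !eqxx/=; case: ifP => ez.
  case: ifP => ez2.
    congr (a _); apply: heisE; rewrite /g !heis_coordE ?ex ?ey; lia.
  apply/eqP/negPn/negP => /hN; rewrite /g !heis_coordE ex; move: ez ez2; lia.
apply/eqP/negPn/negP => /hN; rewrite /g !heis_coordE ex; move: ez; lia.
Qed.

Lemma deltaKV c : delta c * delta c^-1%g = 1.
Proof. by rewrite deltaM mulgV delta1. Qed.
Lemma deltaVK c : delta c^-1%g * delta c = 1.
Proof. by rewrite deltaM mulVg delta1. Qed.

Lemma iotaM_eval P (m : zheis) d : (iota P * m) d =
  \sum_(i < size P) m ((hmk 0 0 i%:Z)^-1 * d)%g * P`_i.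
Proof.
rewrite iotaE mulr_suml zheis_sum; apply: eq_bigr => i _.
by rewrite mulrzAl zheisMz zheis_delta_M.
Qed.

Lemma slope_central n d : slope ((hmk 0 0 n)^-1 * d)%g = slope d.
Proof. by rewrite /slope !heis_coordE hxV hyV !heis_coordE !oppr0 !add0r. Qed.

Lemma fibre_iotaM q P m : fibre q (iota P * m) = iota P * fibre q m.
Proof.
apply/zheisP => d; rewrite fibreE !iotaM_eval; case: ifP => dq.
  by apply: eq_bigr => i _; rewrite fibreE slope_central dq.
by rewrite big1// => i _; rewrite fibreE slope_central dq mul0r.
Qed.

Lemma fibre_iota P : fibre (0, 0) (iota P) = iota P.
Proof.
apply/zheisP => d; rewrite fibreE; case: ifPn => //; rewrite iota_eval.
by rewrite -pair_eqE /= /pair_eq /= andbA => /negPf ->.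
Qed.

(** Multiplication by [iota P] preserves fibres, and on one fibre every element is some [iota Q]
    times a unit; what remains is that Z[X] is a domain. *)
Lemma iotaM_eq0 P m : P != 0 -> iota P * m = 0 -> m = 0.
Proof.
move=> P0 Pm; apply/zheisP => d.
have [Q [n mE]] := fibredP (@fibre_fibred (slope d) m).
have : iota P * fibre (slope d) m = 0.
  rewrite -fibre_iotaM Pm; apply/zheisP => e.
  by rewrite fibreE zheis0 if_same.
rewrite mE mulrA -rmorphM.
move=> /(congr1 (fun a => a * delta (hmk (slope d).1 (slope d).2 n)^-1%g)).
rewrite mul0r -mulrA deltaKV mulr1 -(rmorph0 iota) => /iota_inj/eqP.
rewrite mulf_eq0 (negPf P0)/= => /eqP Q0.
have := fibreE (slope d) m d; rewrite eqxx => <-.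
by rewrite mE Q0 rmorph0 mul0r.
Qed.

Lemma iotaM_inj P (a b : zheis) : P != 0 -> iota P * a = iota P * b -> a = b.
Proof.
move=> P0 ab; apply/eqP; rewrite -subr_eq0; apply/eqP.
by apply: (iotaM_eq0 P0); rewrite mulrBr ab subrr.
Qed.

(** * Primes of Z[X] remain prime in the group ring *)

(** Divisibility in Z[X] proper, whereas [%|] on integral polynomials is only up to nonzero scalars,
    that is, divisibility over Q. *)
Definition zdvd (P A : {poly int}) := exists C, A = P * C.
Definition zprime (P : {poly int}) :=
  P != 0 /\ forall A B, zdvd P (A * B) -> zdvd P A \/ zdvd P B.

Definition idvd (P : {poly int}) (a : zheis) := exists m, a = iota P * m.

Lemma idvdD P a b : idvd P a -> idvd P b -> idvd P (a + b).
Proof. by move=> [m ->] [n ->]; exists (m + n); rewrite mulrDr. Qed.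

Lemma idvdN P a : idvd P a -> idvd P (- a).
Proof. by move=> [m ->]; exists (- m); rewrite mulrN. Qed.

Lemma idvdMr P a b : idvd P a -> idvd P (a * b).
Proof. by move=> [m ->]; exists (m * b); rewrite mulrA. Qed.

Lemma idvdMl P a b : idvd P b -> idvd P (a * b).
Proof. by move=> [m ->]; exists (a * m); rewrite !mulrA iota_comm. Qed.

Lemma zdvd_idvd P A b : zdvd P A -> idvd P (iota A * b).
Proof. by move=> [C ->]; exists (iota C * b); rewrite rmorphM mulrA. Qed.

Lemma delta_zetaX (n : int) :
  exists k, delta (hmk 0 0 n) * zeta ^+ `|n|%N = zeta ^+ k.
Proof.
exists `|(n + `|n|%N%:Z)%R|%N; rewrite !zetaX deltaM; congr delta.
by apply: heisE; rewrite !heis_coordE; lia.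
Qed.

(** After projection to the fibre over (0, 0) the cofactor is a Laurent polynomial in [zeta]; the
    power of ['X] clears its negative exponents. *)
Lemma idvd_zdvd P A c : idvd P (iota A * delta c) ->
  exists n, zdvd P (A * 'X^n).
Proof.
move=> [m Am].
have {Am} : iota A = iota P * (m * delta c^-1%g).
  by rewrite mulrA -Am -mulrA deltaKV mulr1.
move=> Am.
have {}Am : iota A = iota P * fibre (0, 0) (m * delta c^-1%g).
  by rewrite -fibre_iotaM -Am fibre_iota.
have [Q [n mE]] := fibredP (@fibre_fibred (0, 0) (m * delta c^-1%g)).
have [k nk] := delta_zetaX n.
exists `|n|%N, (Q * 'X^k); apply: iota_inj.
have iX j : iota 'X^j = zeta ^+ j by rewrite rmorphXn/= /iota horner_morphX.
by rewrite !rmorphM /= !iX Am mE -!mulrA nk.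
Qed.

Definition lexle (p q : int * int) : bool :=
  (p.1 < q.1) || ((p.1 == q.1) && (p.2 <= q.2)).

Lemma seq_max (T : eqType) (r : rel T) (s : seq T) x :
  reflexive r -> transitive r -> total r -> x \in s ->
  exists2 m, m \in s & forall y, y \in s -> r y m.
Proof.
move=> rr tr to; elim: s x => // a [|b s] IH x _.
  by exists a => [|y]; rewrite ?inE// => /eqP ->.
have [m ms hm] := IH b (mem_head _ _).
have [am|ma] := orP (to a m).
  by exists m => [|y]; rewrite inE ?ms ?orbT// => /predU1P[->//|/hm].
exists a => [|y]; first exact: mem_head.
by rewrite inE => /predU1P[->//|/hm ym]; apply: tr ym ma.
Qed.

Lemma zheis_top (k : zheis) : k != 0 -> exists2 c, k c != 0 &
  forall e, k e != 0 -> lexle (slope e) (slope c).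
Proof.
move=> k0; have [c kc] : exists c, k c != 0.
  apply: contrapT => h; move/eqP: k0; apply; apply/zheisP => c; rewrite zheis0.
  by apply/eqP/negPn/negP => kc; apply: h; exists c.
have := @seq_max _ (fun c d => lexle (slope c) (slope d)) (finsupp k) c.
case.
- by move=> x; rewrite /lexle; lia.
- by move=> x y z; rewrite /lexle; lia.
- by move=> x y; rewrite /lexle; lia.
- by rewrite mem_finsupp.
move=> m; rewrite mem_finsupp => km hm; exists m => // e ke.
by apply: hm; rewrite mem_finsupp.
Qed.

(** The lexicographic order is compatible with addition, so two slopes bounded by [p] and [q] add up
    to [p + q] only if they are equal to [p] and [q]. *)
Lemma fibre_top (k f : zheis) (p q : int * int) :
  (forall c, k c != 0 -> lexle (slope c) p) ->
  (forall c, f c != 0 -> lexle (slope c) q) ->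
  fibre (p.1 + q.1, p.2 + q.2) (k * f) = fibre p k * fibre q f.
Proof.
move=> kp fq; apply/zheisP => d; rewrite fibreE !zheisM.
rewrite (@pairing_sub _ (finsupp k) (fibre p k)); last first.
  by apply/fsubsetP => c; rewrite !mem_finsupp fibreE; case: ifP; rewrite ?eqxx.
case: ifPn => dpq.
  apply: eq_big_seq => c; rewrite mem_finsupp => /[dup] kc /kp cp; rewrite !fibreE.
  have [->|/fq dq] := eqVneq (f (c^-1 * d)%g) 0; first by rewrite if_same !mul0rz.
  have sd1 : hx d = p.1 + q.1 by move/eqP: dpq => [].
  have sd2 : hy d = p.2 + q.2 by move/eqP: dpq => [].
  move: cp dq; rewrite /lexle /slope /= hxM hyM hxV hyV sd1 sd2 => cp dq.
  have e1 : hx c = p.1 by lia.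
  have e2 : hy c = p.2 by lia.
  by rewrite e1 e2 !addKr -!surjective_pairing !eqxx.
rewrite big1_seq// => c _; rewrite !fibreE.
have [cp|_] := eqVneq (slope c) p; last by rewrite mulr0z.
have [dq|_] := eqVneq (slope (c^-1 * d)%g) q; last by rewrite mul0rz.
case/negP: dpq; rewrite -cp -dq /slope /= hxM hyM hxV hyV.
by apply/eqP; congr (_, _); lia.
Qed.

(** The decreasing measure of the induction in [idvd_prime]. *)
Lemma finsupp_fibreB q (k : zheis) c : slope c = q -> k c != 0 ->
  (#|` finsupp (k - fibre q k)%R| < #|` finsupp k|)%N.
Proof.
move=> cq kc; apply: fproper_ltn_card; apply/andP; split.
  apply/fsubsetP => d; rewrite !mem_finsupp zheisD zheisN fibreE.
  by case: ifP; rewrite ?subrr ?eqxx ?subr0.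
apply/fsubsetPn; exists c; rewrite ?mem_finsupp// zheisD zheisN fibreE cq.
by rewrite eqxx subrr eqxx.
Qed.

(* Order Z^2 lexicographically: the leading fibre of [k * f] is the product of
   the leading fibres of [k] and [f], which reduces the claim to Z[X]; then
   peel off the leading fibre that is divisible by [P]. *)
Lemma idvd_prime P (k f : zheis) : zprime P ->
  idvd P (k * f) -> idvd P k \/ idvd P f.
Proof.
move=> [P0 Pp]; have idvd0 : idvd P 0 by exists 0; rewrite mulr0.
have [n] := ubnP (#|` finsupp k| + #|` finsupp f|)%N.
elim: n k f => // n IH k f; rewrite ltnS => nkf Pkf.
have [->|k0] := eqVneq k 0; first by left.
have [->|f0] := eqVneq f 0; first by right.
have [c kc ck] := zheis_top k0; have [e fe ef] := zheis_top f0.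
have [Q1 [n1 E1]] := fibredP (@fibre_fibred (slope c) k).
have [Q2 [n2 E2]] := fibredP (@fibre_fibred (slope e) f).
have : idvd P (fibre (slope c) k * fibre (slope e) f).
  rewrite -fibre_top//; case: Pkf => m ->.
  by exists (fibre (hx c + hx e, hy c + hy e) m); rewrite fibre_iotaM.
rewrite E1 E2 -mulrA (mulrA (delta _)) -iota_comm -mulrA deltaM mulrA -rmorphM.
move=> /idvd_zdvd[N] /Pp[/Pp[PQ|PQ]|[C XC]].
- have dk : idvd P (fibre (slope c) k) by rewrite E1; apply: zdvd_idvd.
  have : idvd P ((k - fibre (slope c) k) * f).
    by rewrite mulrBl; apply: idvdD => //; apply/idvdN/idvdMr.
  case/IH => [|h|h]; last by right.
    by apply: leq_trans nkf; rewrite ltn_add2r (finsupp_fibreB _ kc).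
  by left; rewrite -(subrK (fibre (slope c) k) k); apply: idvdD.
- have df : idvd P (fibre (slope e) f) by rewrite E2; apply: zdvd_idvd.
  have : idvd P (k * (f - fibre (slope e) f)).
    by rewrite mulrBr; apply: idvdD => //; apply/idvdN/idvdMl.
  case/IH => [|h|h]; first 1 last.
  + by left.
  + by right; rewrite -(subrK (fibre (slope e) f) f); apply: idvdD.
  by apply: leq_trans nkf; rewrite ltn_add2l (finsupp_fibreB _ fe).
(* Here [P] divides a power of ['X], so [iota P] is a unit and divides everything. *)
left; exists (iota C * delta (hmk 0 0 N%:Z)^-1%g * k).
rewrite !mulrA -rmorphM -XC rmorphXn /= /iota horner_morphX zetaX deltaKV.
by rewrite mul1r.
Qed.

(** * Primes and factorisation in Z[X] *)

Lemma zdvdC (p : int) A : zdvd p%:P A <-> (p %| zcontents A)%Z.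
Proof.
rewrite dvdz_contents; split=> [[C ->]|/polyOverP pA].
  by apply/polyOverP => i; rewrite mul_polyC coefZ dvdz_mulr.
exists (map_poly (divz^~ p) A); rewrite mul_polyC; apply/polyP => i.
by rewrite coefZ coef_map_id0 ?div0z// mulrC divzK.
Qed.

(** Gauss's lemma: the content is multiplicative, so Euclid's lemma for [p] can be applied to
    contents. *)
Lemma zprime_polyC (p : nat) : prime p -> zprime (p%:Z)%:P.
Proof.
move=> pp; split; first by rewrite polyC_eq0; case: p pp.
move=> A B /zdvdC; rewrite zcontentsM dvdzE abszM /= Euclid_dvdM//.
by case/orP => h; [left|right]; apply/zdvdC; rewrite dvdzE.
Qed.

(** [irreducible_poly] is irreducibility over Q, where irreducibles are prime; and a primitive
    polynomial that divides over Q also divides over Z. *)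
Lemma zprime_irreducible P : irreducible_poly P -> zprime (zprimitive P).
Proof.
move=> irr; have P0 := irredp_neq0 irr; split; first by rewrite zprimitive_eq0.
move=> A B [C ABC].
have zP D : P %| D -> zdvd (zprimitive P) D by case/dvdpP_int => r ->; exists r.
have PzP : zprimitive P %= P.
  rewrite {2}(zpolyEprim P) eqp_sym eqp_scale//.
  by rewrite zcontents_eq0.
have : P %| A * B by rewrite ABC -(eqp_dvdl _ PzP) dvdp_mulIl.
have [PA|PA] := boolP (P %| A); first by left; apply: zP.
rewrite Gauss_dvdpr; first by move/zP; right.
apply/coprimepP => d dP dA; rewrite -size_poly_eq1.
apply/negPn/negP => d1; have := irr.2 _ d1 dP => /eqp_dvdl dE.
by rewrite -dE dA in PA.
Qed.

Lemma irreducible_divisor (G : {poly int}) : (1 < size G)%N ->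
  exists2 P, irreducible_poly P & P %| G.
Proof.
have [n] := ubnP (size G); elim: n G => // n IH G; rewrite ltnS => Gn G1.
have [h|h] := pselect (forall q : {poly int}, size q != 1%N -> q %| G -> q %= G).
  by exists G.
have {h} [q q1 [qG nqG]] : exists2 q : {poly int}, size q != 1%N &
    q %| G /\ ~~ (q %= G).
  apply: contrapT => h'; apply: h => q q1 qG; apply/negPn/negP => nqG.
  by apply: h'; exists q.
have G0 : G != 0 by rewrite -size_poly_gt0 (ltn_trans _ G1).
have q0 : q != 0 by apply: contraNneq G0 => q0; rewrite q0 dvd0p in qG.
have ltq : (size q < size G)%N.
  by rewrite ltn_neqAle dvdp_leq// andbT dvdp_size_eqp.
have [||P iP Pq] := IH q.
- exact: leq_trans ltq Gn.
- by rewrite ltn_neqAle eq_sym q1 size_poly_gt0.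
by exists P => //; apply: dvdp_trans qG.
Qed.

(** Existence of prime factorisations, as an induction principle: primitive parts of irreducible
    divisors are split off until a constant is left, which is a sign times a product of prime
    numbers. *)
Lemma zpoly_prime_ind (T : {poly int} -> Prop) :
  T 1 -> T (-1) -> (forall P, zprime P -> T P) ->
  (forall P Q, T P -> T Q -> T (P * Q)) -> forall G, G != 0 -> T G.
Proof.
move=> T1 TN1 Tp TM.
have Tn (n : nat) : (0 < n)%N -> T (n%:Z)%:P.
  have [m] := ubnP n; elim: m n => // m IH n; rewrite ltnS => nm n0.
  have [->|n1] := eqVneq n 1%N; first exact: T1.
  have n1' : (1 < n)%N by rewrite ltn_neqAle eq_sym n1.
  have pp := pdiv_prime n1'.
  have nE : n = (n %/ pdiv n * pdiv n)%N by rewrite divnK// pdiv_dvd.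
  rewrite nE PoszM polyCM; apply: TM; last exact/Tp/zprime_polyC.
  have q0 : (0 < n %/ pdiv n)%N by rewrite divn_gt0 ?pdiv_gt0// pdiv_leq.
  apply: IH => //; apply: leq_trans nm.
  by rewrite ltn_Pdiv// prime_gt1.
have Tc (c : int) : c != 0 -> T c%:P.
  move=> c0; rewrite [c]intEsign polyCM; apply: TM; last first.
    by apply: Tn; rewrite absz_gt0.
  by case: (c < 0)%R; rewrite ?expr1 ?expr0 ?polyCN.
move=> G; have [n] := ubnP (size G); elim: n G => // n IH G; rewrite ltnS => Gn G0.
have [G1|G1] := leqP (size G) 1.
  by have := size1_polyC G1 => GE; rewrite GE; apply: Tc; rewrite -polyC_eq0 -GE.
have [P iP /dvdpP_int[r GE]] := irreducible_divisor G1.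
have r0 : r != 0 by apply: contraNneq G0 => r0; rewrite GE r0 mulr0.
rewrite GE; apply: TM; first exact/Tp/zprime_irreducible.
apply: IH => //; apply: leq_trans Gn.
have P0 := irredp_neq0 iP.
rewrite GE size_mul ?zprimitive_eq0// size_zprimitive.
by case: (size P) iP.1 => [|[|m]]// _; rewrite !addSn /= ltnS leq_addl.
Qed.

(** * Central elements and their action on Z[H] / Z[H] f *)

Lemma hz_conj (c e : heis) :
  hz (e^-1 * c * e)%g = hz c + hx c * hy e - hx e * hy c.
Proof.
have : hz (e * (e^-1 * c * e))%g = hz (c * e)%g by rewrite !mulgA mulgV mul1g.
by rewrite !hzM !hyM !hyV; lia.
Qed.

(** A central element is constant on conjugacy classes; the class of a group element of nonzero
    slope is infinite, whereas the support is finite. *)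
Lemma central_fibred (g : zheis) : zheis_central g -> fibred (0, 0) g.
Proof.
move=> gc c sc; apply/eqP/negPn/negP => gc0.
have inv (e : heis) : g (e^-1 * c * e)%g = g c.
  have /(congr1 (fun a : zheis => a (c * e)%g)) := gc (delta e).
  rewrite [LHS](zheisM_delta g) [RHS](zheis_delta_M g).
  by rewrite mulgA mulgK.
have [N hN] := hz_bounded g; have hc := hN _ gc0.
(* With x, y the slope of [c], conjugation by [e] raises [hz] by (x^2 + y^2) M, hence by at least 2N
   + 1, which is too far for two values of absolute value at most [N]. *)
pose M : int := 2 * N%:Z + 1.
pose e := hmk (- hy c * M) (hx c * M) 0; have := hN (e^-1 * c * e)%g.
rewrite inv hz_conj /e !heis_coordE => /(_ gc0).
have : 1 <= hx c * hx c + hy c * hy c.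
  have : (hx c != 0) || (hy c != 0).
    rewrite -negb_and; apply: contraNN sc => /andP[/eqP x0 /eqP y0].
    by rewrite /slope x0 y0.
  by case/orP => h; nia.
set t := _ + _ => t1; set z := _ - _.
have -> : z = hz c + t * M by rewrite /z /t; lia.
have : M <= t * M by rewrite /M; nia.
rewrite /M; lia.
Qed.

(** Primes of [g] are cancelled one at a time. If a factor of the central element lay in the left
    ideal Z[H] f, so would the whole product; hence every factor inherits the hypothesis of lying
    outside it. *)
Lemma mul_central_inj_mod (f g : zheis) : zheis_irreducible f ->
  zheis_central g -> ~ (exists h, g = h * f) ->
  forall h k, h * g = k * f -> exists h', h = h' * f.
Proof.
move=> [_ f_irr] gc.
have [G [n]] := fibredP (central_fibred gc); rewrite /= => gE.
pose z := delta (hmk 0 0 n); pose z' := delta (hmk 0 0 n)^-1%g.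
move=> gNf.
have {gNf} GNf : ~ exists h, iota G = h * f.
  move=> [h Gh]; apply: gNf; exists (z * h).
  by rewrite gE -/z /z -delta_central Gh mulrA.
suff H : forall h k, h * iota G = k * f -> exists h', h = h' * f.
  move=> h k; rewrite gE => hk; apply: (H h (z' * k)).
  by rewrite -mulrA -hk (mulrA h) -delta_central mulrA deltaVK mul1r.
have G0 : G != 0.
  by apply/eqP => G0; apply: GNf; exists 0; rewrite mul0r G0 rmorph0.
move: {gE} G G0 GNf.
apply: (@zpoly_prime_ind (fun G => (~ exists h, iota G = h * f) ->
   forall h k, h * iota G = k * f -> exists h', h = h' * f)).
- by move=> _ h k; rewrite rmorph1 mulr1 => ->; exists k.
- move=> _ h k; rewrite rmorphN rmorph1 mulrN1 => hk; exists (- k).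
  by rewrite mulNr -hk opprK.
- move=> P Pp PNf h k hk.
  have P0 := Pp.1.
  have : idvd P (k * f) by exists h; rewrite -hk iota_comm.
  case/(idvd_prime Pp) => [[m km]|[m fm]].
    exists m; apply: (iotaM_inj P0).
    by rewrite iota_comm hk km mulrA.
  (* A unit [iota P] can be divided out; a unit [m] would make [iota P] a left multiple of [f]. *)
  case: (f_irr _ _ fm) => [[b [bP Pb]]|[b [bm mb]]].
    exists (b * k); rewrite -mulrA -hk -iota_comm mulrA.
    by rewrite (_ : b * iota P = 1) ?mul1r.
  case: PNf; exists b; rewrite fm iota_comm mulrA.
  by rewrite (_ : b * m = 1) ?mul1r.
- move=> P Q HP HQ PQNf h k; rewrite rmorphM/= mulrA => hk.
  have QNf : ~ exists h, iota Q = h * f.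
    move=> [j Qj]; apply: PQNf; exists (iota P * j).
    by rewrite rmorphM/= Qj mulrA.
  have PNf : ~ exists h, iota P = h * f.
    move=> [j Pj]; apply: PQNf; exists (iota Q * j).
    by rewrite mulrC rmorphM/= Pj mulrA.
  have [h' /(HP PNf)] := HQ QNf _ _ hk.
  by [].
Qed.

(** * Homomorphisms into divisible groups *)

Section DivisibleExtension.
Variables A D : zmodType.
Hypothesis divD : forall (d : D) (n : nat), (0 < n)%N -> exists e, e *+ n = d.

(** These are the graphs of homomorphisms from a subgroup of [A] to [D]: subgroups of the product
    that meet 0 x D trivially. *)
Definition additive_graph (S : set (A * D)) : Prop :=
  [/\ S (0, 0), forall p q, S p -> S q -> S (p - q) &
      forall d, S (0, d) -> d = 0].

Section Graph.
Variable S : set (A * D).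
Hypothesis gS : additive_graph S.

Lemma additive_graphN p : S p -> S (- p).
Proof. by case: gS => S0 SB _ Sp; rewrite -[- p]sub0r; apply: SB. Qed.

Lemma additive_graphD p q : S p -> S q -> S (p + q).
Proof.
by case: (gS) => _ SB _ Sp Sq; rewrite -[q]opprK; apply/SB/additive_graphN.
Qed.

Lemma additive_graphMz p (n : int) : S p -> S (p *~ n).
Proof.
move=> Sp; have pos (m : nat) : S (p *+ m).
  elim: m => [|m IH]; first by case: gS.
  by rewrite mulrS; apply: additive_graphD.
by case: n => m; [exact: pos|exact/additive_graphN/pos].
Qed.

Lemma additive_graph_fun a d e : S (a, d) -> S (a, e) -> d = e.
Proof.
case: gS => _ SB Sf Sd Se; apply/eqP; rewrite -subr_eq0; apply/eqP/Sf.
by have := SB _ _ Sd Se; rewrite -[X in S X]/(a - a, d - e) subrr.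
Qed.

Lemma pairMz (a : A) (d : D) (n : int) : (a, d) *~ n = (a *~ n, d *~ n).
Proof.
have pos (m : nat) : (a, d) *+ m = (a *+ m, d *+ m).
  by elim: m => // m IH; rewrite !mulrS IH.
by case: n => m; rewrite ?NegzE -?pmulrn ?mulrNz -?pmulrn pos.
Qed.

(* A value [d] at [a] is compatible with [S] as soon as it is at the least
   positive multiple of [a] in the domain of [S]. *)
Lemma additive_graph_value (a : A) :
  exists d, forall (n : int) t, S (a *~ n, t) -> t = d *~ n.
Proof.
have [S0 SB Sf] := gS.
have [[n0 n0P]|none] :=
  pselect (exists n, `[< (0 < n)%N /\ exists t, S (a *+ n, t) >]).
  have exn : exists n, `[< (0 < n)%N /\ exists t, S (a *+ n, t) >] by exists n0.
  case: (ex_minnP exn) => m /asboolP[m0 [t0 St0]] mmin.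
  have [d dm] := divD t0 m0; exists d => n t St.
  have m0' : m%:Z != 0 by rewrite eqz_nat -lt0n.
  have := divz_eq n m%:Z; have := modz_ge0 n m0'.
  have := ltz_pmod n (m0 : 0 < m%:Z).
  move: (n %/ m%:Z)%Z (n %% m%:Z)%Z => q r rm r0 nE.
  (* The remainder [r] also gives a multiple of [a] in the domain, and it is smaller than the least
     positive one, so it is zero. *)
  have Sr : S (a *~ r, t - t0 *~ q).
    have := SB _ _ St (additive_graphMz q St0).
    rewrite pairMz (_ : _ - _ = (a *~ n - a *+ m *~ q, t - t0 *~ q))//.
    congr (S (_, _)); rewrite nE mulrzDr pmulrn -mulrzA (mulrC m%:Z).
    by rewrite addrAC subrr add0r.
  have r00 : r = 0.
    case: r r0 rm Sr {nE} => // -[//|r] _ rm Sr.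
    move: rm; rewrite ltz_nat ltnNge => /negP[]; apply: mmin.
    by apply/asboolP; split => //; exists (t - t0 *~ q).
  move: Sr; rewrite r00 => /Sf/eqP; rewrite subr_eq0 => /eqP ->.
  by rewrite nE r00 addr0 -dm pmulrn -mulrzA mulrC.
(* No positive multiple of [a] lies in the domain, hence no negative one either; only [n = 0]
   remains. *)
exists 0 => n t St; rewrite mul0rz.
have pos (k : nat) s : ~ S (a *+ k.+1, s).
  by move=> Sk; apply: none; exists k.+1; apply/asboolP; split => //; exists s.
case: n St => [[|k]|k] St; [exact: Sf|by case: (pos k t)|].
have := additive_graphN St; rewrite NegzE mulrNz.
rewrite (_ : - _ = (a *+ k.+1, - t)); first by move/pos.
by congr (_, _); rewrite /= opprK.
Qed.

End Graph.

(** Divisible groups are injective: by Zorn's lemma there is a maximal graph containing [S], and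
    [additive_graph_value] would enlarge it at any point where it is undefined. *)
Lemma divisible_extension (S : set (A * D)) : additive_graph S ->
  exists phi : {additive A -> D}, forall p, S p -> phi p.1 = p.2.
Proof.
move=> gS.
(* The guard [X !=set0] makes the union of the empty chain good as well. *)
pose good (X : set (A * D)) := X !=set0 -> S `<=` X /\ additive_graph X.
have [M [gM Mmax]] : exists M, good M /\ forall B, M `<` B -> ~ good B.
  apply: Zorn_bigcup => F Fgood Ftot [p [X FX Xp]].
  have Xg Y : F Y -> Y !=set0 -> S `<=` Y /\ additive_graph Y by exact: Fgood.
  have [SX [X0 _ _]] := Xg _ FX (ex_intro _ p Xp).
  split; first by move=> q /SX Xq; exists X.
  split; first by exists X.
    move=> q r [Y FY Yq] [Z FZ Zr].
    have [YZ|ZY] := Ftot _ _ FY FZ.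
      have [_ [_ ZB _]] := Xg _ FZ (ex_intro _ r Zr).
      by exists Z => //; apply: ZB => //; apply: YZ.
    have [_ [_ YB _]] := Xg _ FY (ex_intro _ q Yq).
    by exists Y => //; apply: YB => //; apply: ZY.
  move=> d [Y FY Yd]; have [_ [_ _ Yf]] := Xg _ FY (ex_intro _ _ Yd).
  exact: Yf.
have M0 : M !=set0.
  apply: contrapT => nM; apply: (Mmax S) => [|_]; last by split.
  split; first by move=> p Mp; case: nM; exists p.
  by move=> SM; apply: nM; exists (0, 0); apply: SM; case: gS.
have {gM}[SM gM] := gM M0; have [M00 MB Mf] := gM.
have tot a : exists d, M (a, d).
  apply: contrapT => na; have [d dP] := additive_graph_value gM a.
  (* The subgroup generated by [M] and [(a, d)]; the choice of [d] keeps it a graph. *)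
  pose M' := [set p | exists q (n : int), M q /\ p = q + (a, d) *~ n].
  have MM' : M `<=` M' by move=> p Mp; exists p, 0; rewrite mulr0z addr0.
  apply: (Mmax M') => [|_].
    split=> // M'M; apply: na; exists d; apply: M'M; exists (0, 0), 1.
    by rewrite mulr1z add0r.
  split; first by move=> p /SM/MM'.
  split; first exact: MM'.
    move=> _ _ [p [n [Mp ->]]] [q [m [Mq ->]]]; exists (p - q), (n - m).
    by split; [exact: MB|rewrite mulrzBr opprD addrACA].
  move=> e [[b t] [n [Mbt]]]; rewrite pairMz => -[b0 ->].
  have := additive_graphN gM Mbt.
  rewrite (_ : - _ = (a *~ n, - t)).
    by move/dP => tE; rewrite -tE subrr.
  by congr (_, _) => /=; apply/eqP; rewrite eq_sym -addr_eq0 addrC -b0.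
have [phi phiP] := choice tot.
have phiB : zmod_morphism phi.
  move=> a b; apply: (additive_graph_fun gM (phiP _)).
  by have := MB _ _ (phiP a) (phiP b).
pose Phi : {additive A -> D} :=
  HB.pack phi (GRing.isZmodMorphism.Build _ _ phi phiB).
exists Phi.
move=> [a d] /SM Mad /=; apply: (additive_graph_fun gM _ Mad); exact: phiP.
Qed.

End DivisibleExtension.

Lemma delta_pairing d (g : zheis) :
  pairing g (fun c => delta (d * c)%g) = delta d * g.
Proof.
rewrite {2}(zheis_sum_delta g) mulr_sumr; apply: eq_bigr => c _.
by rewrite mulrzAr deltaM.
Qed.

(** A function [y] is the same as a homomorphism from Z[H] to [V]. The two requirements prescribe it
    on Z[H] g + Z[H] f by sending [h * g + k * f] to [pairing h x]. This is well defined because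
    [h * g] in Z[H] f forces [h] into Z[H] f, where pairing with [x] vanishes; divisibility of [V]
    extends it to Z[H]. *)
Lemma pairing_solvable (V : zmodType) (f g : zheis) (x : heis -> V) :
  (forall (d : V) n, (0 < n)%N -> exists e, e *+ n = d) ->
  (forall h k, h * g = k * f -> exists h', h = h' * f) ->
  (forall d, pairing f (fun c => x (d * c)%g) = 0) ->
  exists y, (forall d, pairing f (fun c => y (d * c)%g) = 0) /\
    (forall d, pairing g (fun c => y (d * c)%g) = x d).
Proof.
move=> divV g_inj xf.
pose S := [set p : zheis * V | exists h k, p = (h * g + k * f, pairing h x)].
have gS : additive_graph S.
  split.
  - by exists 0, 0; rewrite !mul0r addr0 pairing0l.
  - move=> _ _ [h [k ->]] [h' [k' ->]]; exists (h - h'), (k - k').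
    rewrite pairingDl pairingNl; congr (_, _) => /=.
    by rewrite !mulrBl opprD addrACA.
  - move=> d [h [k [/esym/eqP]]]; rewrite addr_eq0 -mulNr => /eqP /g_inj[h' ->] ->.
    rewrite pairingM (eq_pairing _ xf) /pairing big1// => c _; exact: mul0rz.
have [phi phiS] := divisible_extension divV gS.
have phi_mul d a : pairing a (fun c => phi (delta (d * c)%g)) = phi (delta d * a).
  by rewrite -delta_pairing raddf_pairing.
exists (phi \o delta); split => d; rewrite phi_mul.
  by apply: (phiS (_, _)); exists 0, (delta d); rewrite mul0r add0r pairing0l.
apply: (phiS (_, _)); exists (delta d), 0.
by rewrite mul0r addr0 pairing_delta.
Qed.

(** * Absolutely summable functions *)

Section Sums.
Variable R : realType.
Implicit Types (p n u v w : heis -> R) (a : zheis).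

Lemma ell1_le u w : (forall c, `|u c| <= `|w c|) -> ell1 w -> ell1 u.
Proof.
by move=> uw; apply: le_lt_trans; apply: le_esum => c _ /=; rewrite lee_fin.
Qed.

Lemma ell1D u w : ell1 u -> ell1 w -> ell1 (fun c => u c + w c).
Proof. exact: summableD. Qed.

Lemma ell1Mn u k : ell1 u -> ell1 (fun c => u c *+ k).
Proof.
move=> u1; elim: k => [|k IH].
  by apply: ell1_le u1 => c; rewrite mulr0n normr0.
by under eq_fun do rewrite mulrS; apply: ell1D.
Qed.

Lemma ell1_bounded_mul (K : R) v w :
  (forall c, `|v c| <= K) -> ell1 w -> ell1 (fun c => v c * w c).
Proof.
(* A natural number above [K] reduces scaling to repeated addition. *)
move=> vK w1; apply: ell1_le (ell1Mn (Num.bound K) w1) => c.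
rewrite normrM normrMn -mulr_natl ler_wpM2r// (le_trans (vK c))// ltW//.
by rewrite archi_boundP// (le_trans _ (vK c)).
Qed.

Lemma ell1_reindex u (s : heis -> heis) : bijective s -> ell1 u ->
  ell1 (fun c => u (s c)).
Proof.
move=> bs; rewrite /ell1 /= /summable (@reindex_esum R _ _ setT setT s)//.
by rewrite setTT_bijective.
Qed.

Definition nonneg_sum p : R := fine (\esum_(c in [set: heis]) (p c)%:E)%E.

Lemma nonneg_sum_fin p : (forall c, 0 <= p c) -> ell1 p ->
  (\esum_(c in [set: heis]) (p c)%:E)%E \is a fin_num.
Proof.
move=> p0; rewrite /ell1 /= summableE; congr (_ \is a _).
by apply: eq_esum => c _ /=; rewrite ger0_norm.
Qed.

(** The sum may be computed from any splitting into nonnegative summable parts, not only from the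
    positive and negative parts. Linearity follows, since splittings can be added while positive
    parts cannot. *)
Lemma heis_sum_diff p n : (forall c, 0 <= p c) -> (forall c, 0 <= n c) ->
  ell1 p -> ell1 n ->
  heis_sum (fun c => p c - n c) = nonneg_sum p - nonneg_sum n.
Proof.
move=> p0 n0 p1 n1; rewrite /nonneg_sum -fineB ?nonneg_sum_fin//.
rewrite /heis_sum; congr fine.
by apply: (@esumB _ _ _ (EFin \o p) (EFin \o n)) => // c _; rewrite lee_fin.
Qed.

Lemma nonneg_sumD p n : (forall c, 0 <= p c) -> (forall c, 0 <= n c) ->
  ell1 p -> ell1 n ->
  nonneg_sum (fun c => p c + n c) = nonneg_sum p + nonneg_sum n.
Proof.
move=> p0 n0 p1 n1; rewrite /nonneg_sum -fineD ?nonneg_sum_fin//.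
by congr fine; rewrite -esumD// => c _; rewrite lee_fin.
Qed.

Lemma nonneg_decomposition u : ell1 u -> exists p n,
  [/\ (forall c, 0 <= p c), (forall c, 0 <= n c), ell1 p, ell1 n &
      u = (fun c => p c - n c)].
Proof.
move=> u1; exists (fun c => Num.max (u c) 0), (fun c => Num.max (- u c) 0).
split.
- by move=> c; rewrite le_max lexx orbT.
- by move=> c; rewrite le_max lexx orbT.
- apply: ell1_le u1 => c; rewrite maxEle; case: ifP => _;
    by rewrite ?normr0 ?normr_ge0 ?lexx.
- apply: ell1_le u1 => c; rewrite maxEle; case: ifP => _;
    by rewrite ?normr0 ?normrN ?normr_ge0 ?lexx.
by apply/funext => c; rewrite !maxEle; case: ifP; case: ifP; lra.
Qed.

Lemma heis_sumD u v : ell1 u -> ell1 v ->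
  heis_sum (fun c => u c + v c) = heis_sum u + heis_sum v.
Proof.
move=> /nonneg_decomposition[p [n [p0 n0 p1 n1 ->]]].
move=> /nonneg_decomposition[q [m [q0 m0 q1 m1 ->]]].
rewrite !heis_sum_diff// addrACA -opprD -!nonneg_sumD// -heis_sum_diff//.
- by congr heis_sum; apply/funext => c; rewrite opprD addrACA.
- by move=> c; rewrite addr_ge0.
- by move=> c; rewrite addr_ge0.
- exact: ell1D.
- exact: ell1D.
Qed.

Lemma heis_sumN u : ell1 u -> heis_sum (fun c => - u c) = - heis_sum u.
Proof.
move=> /nonneg_decomposition[p [n [p0 n0 p1 n1 ->]]].
under eq_fun do rewrite opprB.
by rewrite !heis_sum_diff// opprB.
Qed.

Lemma heis_sum_finite u (S : {fset heis}) : (forall c, c \notin S -> u c = 0) ->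
  heis_sum u = \sum_(c <- S) u c.
Proof.
move=> uS.
have fin p : (forall c, 0 <= p c) -> (forall c, c \notin S -> p c = 0) ->
    (\esum_(c in [set: heis]) (p c)%:E = (\sum_(c <- S) p c)%:E)%E.
  move=> p0 pS; have -> : (\esum_(c in [set: heis]) (p c)%:E =
      \esum_(c in [set` S]) (p c)%:E)%E.
    rewrite [RHS]esum_mkcond; apply: eq_esum => c _.
    by rewrite mem_setE; case: ifPn => // /pS ->.
  rewrite esum_fset => [||c _]; [|exact: finite_fset|by rewrite lee_fin].
  by rewrite -fsbig_seq ?fset_uniq// sumEFin.
have ell1S p : (forall c, c \notin S -> p c = 0) -> ell1 p.
  move=> pS; rewrite /ell1 /= /summable.
  rewrite (fin (fun c => `|p c|)) ?ltry// => c /pS ->; exact: normr0.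
pose p' c := Num.max (u c) 0; pose n' c := Num.max (- u c) 0.
have p'0 c : 0 <= p' c by rewrite le_max lexx orbT.
have n'0 c : 0 <= n' c by rewrite le_max lexx orbT.
have p'S c : c \notin S -> p' c = 0 by move=> /uS uc; rewrite /p' uc maxxx.
have n'S c : c \notin S -> n' c = 0 by move=> /uS uc; rewrite /n' uc oppr0 maxxx.
have uE : u = (fun c => p' c - n' c).
  by apply/funext => c; rewrite /p' /n' !maxEle; case: ifP; case: ifP; lra.
rewrite {1}uE heis_sum_diff ?/nonneg_sum ?fin//; [|exact: ell1S..].
by rewrite /= -sumrB; apply: eq_bigr => c _; rewrite uE.
Qed.

Lemma heis_sum0 : heis_sum (fun=> 0 : R) = 0.
Proof. by rewrite (@heis_sum_finite _ fset0)// big_seq_fset0. Qed.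

Lemma ell1_0 : ell1 (fun=> 0 : R).
Proof.
by rewrite /ell1 /= /summable esum1// => c _; rewrite /= normr0.
Qed.

Lemma ell1N u : ell1 u -> ell1 (fun c => - u c).
Proof. by apply: ell1_le => c; rewrite normrN. Qed.

Lemma ell1Mz u (k : int) : ell1 u -> ell1 (fun c => u c *~ k).
Proof.
by case: k => k u1; [exact: ell1Mn|exact/ell1N/ell1Mn].
Qed.

Lemma heis_sumMz u (k : int) : ell1 u ->
  heis_sum (fun c => u c *~ k) = heis_sum u *~ k.
Proof.
move=> u1; have pos (m : nat) : heis_sum (fun c => u c *+ m) = heis_sum u *+ m.
  elim: m => [|m IH]; first exact: heis_sum0.
  rewrite mulrS -IH -heis_sumD//; last exact: ell1Mn.
  by under eq_fun do rewrite mulrS.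
case: k => k; first exact: pos.
by rewrite NegzE mulrNz -pmulrn -pos -heis_sumN//; exact: ell1Mn.
Qed.

Lemma heis_sum_pairing a (F : heis -> heis -> R) : (forall e, ell1 (F e)) ->
  heis_sum (fun c => pairing a (fun e => F e c)) =
  pairing a (fun e => heis_sum (F e)).
Proof.
move=> F1; rewrite /pairing; elim: (finsupp a : seq heis) => [|e s IH].
  by under eq_fun do rewrite big_nil; rewrite big_nil heis_sum0.
rewrite big_cons -IH -heis_sumMz// -heis_sumD.
- by congr heis_sum; apply/funext => c; rewrite big_cons.
- exact: ell1Mz.
elim: s {IH} => [|e' s IH].
  by under eq_fun do rewrite big_nil; exact: ell1_0.
by under eq_fun do rewrite big_cons; apply: ell1D IH; exact: ell1Mz.
Qed.

Lemma heis_sum_reindex u (s : heis -> heis) : bijective s ->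
  heis_sum (fun c => u (s c)) = heis_sum u.
Proof.
move=> bs; have bs' : set_bij [set: heis] [set: heis] s by rewrite setTT_bijective.
congr fine; congr (_ - _)%E.
  rewrite [RHS](@reindex_esum R _ _ setT setT s _ bs').
  by apply: eq_esum => c _; rewrite !funeposE.
rewrite [RHS](@reindex_esum R _ _ setT setT s _ bs').
by apply: eq_esum => c _; rewrite !funenegE.
Qed.

Lemma heis_sum_zheis a x :
  heis_sum (fun c => real_of_zheis R a c * x c) = pairing a x.
Proof.
rewrite (@heis_sum_finite _ (finsupp a)).
  by apply: eq_bigr => c _; rewrite mulrzl.
by move=> c ca; rewrite /real_of_zheis (fsfun_dflt ca) mul0r.
Qed.

End Sums.

(** * The map xi *)

Section Torus.
Variable R : realType.

Lemma to_torusB : zmod_morphism (@to_torus R).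
Proof. exact: (raddfB (\pi_(Quotient.quot (integers R))%qT)). Qed.

HB.instance Definition _ :=
  GRing.isZmodMorphism.Build R (torus R) (@to_torus R) to_torusB.

Lemma to_torus_eq0 (t : R) : (to_torus t = 0) <-> t \is a Num.int.
Proof.
rewrite -integersE -{2}(subr0 t) -(raddf0 (@to_torus R)) Quotient.idealrBE.
by split=> [h|/eqP//]; exact/eqP.
Qed.

Lemma to_torus_repr (t : torus R) : exists s : R, 0 <= s < 1 /\ to_torus s = t.
Proof.
pose r := repr (t : Quotient.quot (integers R)).
have rE : to_torus r = t by rewrite /to_torus /r reprK.
exists (r - (Num.floor r)%:~R); split.
  have /andP[h1 h2] := Num.Theory.floor_itv r; move: h2; rewrite intrD1; lra.
rewrite raddfB/= rE (_ : to_torus _%:~R = 0) ?subr0//.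
by apply/to_torus_eq0; rewrite intr_int.
Qed.

End Torus.

(** * Convolution with starred summable functions *)

Section Correlation.
Variable R : realType.
Implicit Types (u v w x : heis -> R) (a g : zheis).

Lemma mulgl_bij (d : heis) : bijective (fun c => d * c)%g.
Proof. by exists (fun c => d^-1 * c)%g => c; rewrite ?mulKg ?mulVKg. Qed.

Lemma mulgr_bij (d : heis) : bijective (fun c => c * d)%g.
Proof. by exists (fun c => c * d^-1)%g => c; rewrite ?mulgK ?mulgVK. Qed.

Lemma convol_zheisl a x d :
  convol (real_of_zheis R a) x d = pairing a (fun c => x (c^-1 * d)%g).
Proof. exact: heis_sum_zheis. Qed.

Lemma convol_zheisr x a d :
  convol x (real_of_zheis R a) d = pairing a (fun c => x (d * c^-1)%g).
Proof.
rewrite -heis_sum_zheis /convol.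
have bs : bijective (fun c : heis => (d * c^-1)%g).
  exists (fun c : heis => (c^-1 * d)%g) => c.
    by rewrite invgM invgK mulgVK.
  by rewrite invgM invgK mulVKg.
rewrite -(heis_sum_reindex _ bs); congr heis_sum; apply/funext => c.
by rewrite mulrC invgM invgK mulgVK.
Qed.

Lemma central_commute g c : zheis_central g -> g c != 0 ->
  forall d, (c * d = d * c)%g.
Proof.
move=> /central_fibred gc gc0 d.
have [/eqP|/gc g0] := eqVneq (slope c) (0, 0); last by rewrite g0 eqxx in gc0.
by rewrite /slope => /eqP[x0 y0]; apply: heisE; rewrite !heis_coordE ?x0 ?y0; lia.
Qed.

Lemma eq_pairing_supp (V : zmodType) a (x y : heis -> V) :
  (forall c, a c != 0 -> x c = y c) -> pairing a x = pairing a y.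
Proof. by move=> xy; apply: eq_big_seq => c; rewrite mem_finsupp => /xy ->. Qed.

(** The star reverses products, so the left side is the star of [x g]; the support of [g] is central
    in the group, which turns [x g] into [g x]. *)
Lemma convol_star g x d : zheis_central g ->
  convol (star (real_of_zheis R g)) (star x) d =
  convol (real_of_zheis R g) x d^-1%g.
Proof.
move=> gc; rewrite convol_zheisl.
transitivity (pairing g (fun c => x (c * d)^-1%g)); last first.
  apply: eq_pairing_supp => c /(central_commute gc) cd.
  by rewrite cd invgM.
rewrite -heis_sum_zheis /convol -(heis_sum_reindex _ (inv_bij (@invgK heis))).
by congr heis_sum; apply/funext => c; rewrite /star !invgK.
Qed.

Lemma pairing_heis_delta g d :
  pairing g (fun c => heis_delta R (c^-1 * d)%g) = (g d)%:~R.
Proof.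
rewrite -[g in RHS]mulr1 zheisM (raddf_pairing (intmul 1)).
by apply: eq_pairing => c; rewrite /= zheis_oneE /heis_delta; case: eqP.
Qed.

Lemma pairingMl a (t : R) x : pairing a (fun e => t * x e) = t * pairing a x.
Proof. by rewrite mulr_sumr; apply: eq_bigr => c _; rewrite mulrzAr. Qed.

Lemma pairingMr a (t : R) x : pairing a (fun e => x e * t) = pairing a x * t.
Proof. by rewrite mulrC -pairingMl; apply: eq_pairing => c; rewrite mulrC. Qed.

(** This is the convolution u w^*, with the star unfolded. *)
Definition corr u w d : R := heis_sum (fun c => u c * w (d^-1 * c)%g).

Lemma ell1_transl w (d : heis) : ell1 w -> ell1 (fun c => w (d * c)%g).
Proof. exact/ell1_reindex/mulgl_bij. Qed.

(** In terms of convolutions, (u w^* ) a^* = u (a w)^*. Boundedness of [u] and summability of [w]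
    justify exchanging the sums. *)
Lemma pairing_corr a (K : R) u w d : (forall c, `|u c| <= K) -> ell1 w ->
  pairing a (fun e => corr u w (d * e)%g) =
  corr u (fun c => pairing a (fun e => w (e^-1 * c)%g)) d.
Proof.
move=> uK w1; rewrite -heis_sum_pairing => [|e]; last first.
  exact/(ell1_bounded_mul uK)/ell1_transl.
congr heis_sum; apply/funext => c; rewrite -pairingMl.
by apply: eq_pairing => e; rewrite invgM mulgA.
Qed.

(** In terms of convolutions, (u a^* ) w^* = u (w a)^*. *)
Lemma corr_pairing a (K : R) u w d : (forall c, `|u c| <= K) -> ell1 w ->
  corr (fun c => pairing a (fun e => u (c * e)%g)) w d =
  corr u (fun c => pairing a (fun e => w (c * e^-1)%g)) d.
Proof.
move=> uK w1; rewrite /corr; under eq_fun do rewrite -pairingMr.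
rewrite heis_sum_pairing => [|e]; last first.
  by apply: (@ell1_bounded_mul _ K) => //; exact: ell1_transl.
have -> : (fun c => u c * pairing a (fun e => w (d^-1 * c * e^-1)%g)) =
    fun c => pairing a (fun e => u c * w (d^-1 * c * e^-1)%g).
  by apply/funext => c; rewrite pairingMl.
rewrite heis_sum_pairing => [|e]; last first.
  apply: (ell1_bounded_mul uK).
  under eq_fun do rewrite -mulgA; apply/(@ell1_reindex _ (fun c => w (d^-1 * c)%g)).
    exact: mulgr_bij.
  exact: ell1_transl.
apply: eq_pairing => e; rewrite -[RHS](heis_sum_reindex _ (mulgr_bij e)).
by congr heis_sum; apply/funext => c; rewrite mulgA mulgK.
Qed.

Lemma corr_zheis u a d :
  corr u (real_of_zheis R a) d = pairing a (fun c => u (d * c)%g).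
Proof.
rewrite -heis_sum_zheis /corr -(heis_sum_reindex _ (mulgl_bij d)).
by congr heis_sum; apply/funext => c; rewrite mulKg mulrC.
Qed.

Lemma corrD (K : R) u v w d : (forall c, `|u c| <= K) -> (forall c, `|v c| <= K) ->
  ell1 w -> corr (fun c => u c + v c) w d = corr u w d + corr v w d.
Proof.
move=> uK vK w1; rewrite /corr; under eq_fun do rewrite mulrDl.
by rewrite heis_sumD//; exact/(ell1_bounded_mul _ (ell1_transl _ w1)).
Qed.

Lemma rho_pairing a (x : heis -> torus R) d :
  rho a x d = pairing a (fun c => x (d * c)%g).
Proof. by []. Qed.

Lemma linfZ_bounded (v : linfZ) : exists K : R, forall c, `|real_of_linfZ R v c| <= K.
Proof.
have [K vK] := set_valP v; exists K%:~R => c.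
by rewrite -intr_norm ler_int vK.
Qed.

Definition mk_linfZ (v : heis -> int) (vb : bounded_zfun v) : linfZ :=
  SigSub (mem_set vb).

Section Xi.
Variables (f g : zheis) (fsharp : heis -> R).
Hypothesis g_central : zheis_central g.
Hypothesis fsharpr : convol (real_of_zheis R f) fsharp = heis_delta R.
Hypothesis fsharpl : convol fsharp (real_of_zheis R f) = heis_delta R.
Hypothesis gfsharp1 : ell1 (convol (real_of_zheis R g) fsharp).

Let w := convol (real_of_zheis R g) fsharp.

(** This is f w = f g f^# = g f f^# = g. Both [f] and [g] have finite support, so only finite sums
    are exchanged. *)
Lemma pairing_gfsharpl d : pairing f (fun e => w (e^-1 * d)%g) = (g d)%:~R.
Proof.
under eq_pairing do rewrite /w convol_zheisl.
rewrite pairing_exchange -pairing_heis_delta; apply: eq_pairing_supp => c gc.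
rewrite -fsharpr convol_zheisl; apply: eq_pairing => e; congr fsharp.
rewrite !mulgA -!invgM; congr (_^-1 * _)%g.
by rewrite (central_commute g_central gc).
Qed.

(** This is w f = g f^# f = g. *)
Lemma pairing_gfsharpr d : pairing f (fun e => w (d * e^-1)%g) = (g d)%:~R.
Proof.
under eq_pairing do rewrite /w convol_zheisl.
rewrite pairing_exchange -pairing_heis_delta; apply: eq_pairing => c.
by rewrite -fsharpl convol_zheisr; apply: eq_pairing => e; rewrite mulgA.
Qed.

Lemma xi_corr (v : linfZ) d :
  xi g fsharp v d = to_torus (corr (real_of_linfZ R v) w d).
Proof.
congr to_torus; congr heis_sum; apply/funext => c.
by rewrite convol_star// invgM invgK.
Qed.

Lemma xi_X (v : linfZ) : X_ R f (xi g fsharp v).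
Proof.
move=> d; rewrite rho_pairing.
under eq_pairing do rewrite xi_corr.
rewrite -(raddf_pairing (@to_torus R) f
  (fun e => corr (real_of_linfZ R v) w (d * e)%g)).
have [K vK] := linfZ_bounded v.
rewrite (pairing_corr _ _ vK)//.
have -> : (fun c => pairing f (fun e => w (e^-1 * c)%g)) = real_of_zheis R g.
  by apply/funext => c; exact: pairing_gfsharpl.
rewrite corr_zheis; apply/to_torus_eq0.
by rewrite -(raddf_pairing (intmul 1) g (fun c => v (d * c)%g)) intr_int.
Qed.

Lemma xiD (u v s : linfZ) : (forall c, s c = u c + v c) ->
  forall d, xi g fsharp s d = xi g fsharp u d + xi g fsharp v d.
Proof.
move=> suv d; rewrite !xi_corr -raddfD/=; congr to_torus.
have [K uK] := linfZ_bounded u; have [L vL] := linfZ_bounded v.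
rewrite -(@corrD (Num.max K L))//.
- congr (corr _ w d); apply/funext => c.
  by rewrite /real_of_linfZ -intrD -suv.
- by move=> c; rewrite le_max uK.
- by move=> c; rewrite le_max vL orbT.
Qed.

(* Here [v = u f^*], so that [v w^* = u f^* w^* = u (w f)^* = u g^*]. *)
Lemma xi_lift (x y : heis -> torus R) (u : heis -> R) (K : R) (v : linfZ) :
  (forall d, pairing g (fun c => y (d * c)%g) = x d) ->
  (forall c, `|u c| <= K) -> (forall c, to_torus (u c) = y c) ->
  (forall c, (v c)%:~R = pairing f (fun e => u (c * e)%g)) ->
  xi g fsharp v = x.
Proof.
move=> yx uK uy vE; apply/funext => d; rewrite xi_corr.
have -> : real_of_linfZ R v = fun c => pairing f (fun e => u (c * e)%g).
  by apply/funext => c; exact: vE.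
rewrite (corr_pairing _ _ uK)//.
have -> : (fun c => pairing f (fun e => w (c * e^-1)%g)) = real_of_zheis R g.
  by apply/funext => c; exact: pairing_gfsharpr.
rewrite corr_zheis -yx raddf_pairing.
by apply: eq_pairing => c; exact: uy.
Qed.

(** Reduction modulo 1 maps the pairing to [rho f y c = 0], so it is an integer and equals its
    floor. *)
Lemma lift_int (y : heis -> torus R) (u : heis -> R) c :
  X_ R f y -> (forall c, to_torus (u c) = y c) ->
  (Num.floor (pairing f (fun e => u (c * e)%g)))%:~R =
  pairing f (fun e => u (c * e)%g).
Proof.
move=> yX uy; apply/eqP; rewrite -intrEfloor; apply/to_torus_eq0.
rewrite raddf_pairing -[RHS](yX c) rho_pairing.
by apply: eq_pairing => e; exact: uy.
Qed.

End Xi.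
End Correlation.

(** * Bounds for integral lifts, divisibility of the torus, continuity *)

Section Bounds.
Variable R : realType.
Implicit Types (f : zheis) (u : heis -> R).

Lemma zheis_norm1E f : (zheis_norm1 f)%:~R = \sum_(c <- finsupp f) `|(f c)%:~R| :> R.
Proof.
rewrite /zheis_norm1 (raddf_sum (intmul 1)); apply: eq_bigr => c _ /=.
by rewrite intr_norm.
Qed.

Lemma pairing_le f u (K : R) : (forall c, `|u c| <= K) ->
  `|pairing f u| <= K * (zheis_norm1 f)%:~R.
Proof.
move=> uK; rewrite zheis_norm1E mulr_sumr (le_trans (ler_norm_sum _ _ _))//.
by apply: ler_sum => c _; rewrite -mulrzr normrM ler_wpM2r.
Qed.

Lemma sumr_gt0 (F : heis -> R) (S : {fset heis}) c : c \in S -> 0 < F c ->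
  (forall e, 0 <= F e) -> 0 < \sum_(e <- S) F e.
Proof.
move=> cS Fc F0; rewrite (big_fsetD1 c cS) /=.
by rewrite ltr_pwDl// sumr_ge0.
Qed.

(* The pairing lies in [-|f^-|_1, |f^+|_1) if [f] has a positive coefficient,
   and in (-|f|_1, 0] otherwise. *)
Lemma digit_shift f : f != 0 -> exists k : int, forall u (n : int),
  (forall c, 0 <= u c < 1) -> n%:~R = pairing f u ->
  0 <= n + k <= zheis_norm1 f - 1.
Proof.
move=> f0.
have [[c fc]|fneg] := pselect (exists c, 0 < f c).
  pose m := \sum_(e <- finsupp f) Num.max (- f e) 0.
  exists m => u n u01 nE.
  have mE : m%:~R = \sum_(e <- finsupp f) Num.max (- (f e)%:~R) 0 :> R.
    rewrite (raddf_sum (intmul 1)); apply: eq_bigr => e _ /=.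
    by rewrite !maxEle -mulrNz lerz0; case: ifP.
  apply/andP; split.
    rewrite -(ler0z R) intrD nE mE /pairing -big_split/= sumr_ge0// => e _.
    have /andP[u0 u1] := u01 e; rewrite -[u e *~ _]mulrzr.
    rewrite maxEle; case: ifP; nra.
  have : (n + m)%:~R < (zheis_norm1 f)%:~R :> R.
    rewrite zheis_norm1E intrD nE mE /pairing -big_split/= -subr_gt0 -sumrB.
    (* Strictness comes from the positive coefficient at [c], because [u c < 1]. *)
    apply: (@sumr_gt0 _ _ c).
    - by rewrite mem_finsupp; lia.
    - have /andP[u0 u1] := u01 c; rewrite -[u c *~ _]mulrzr.
      have : 0 < (f c)%:~R :> R by rewrite ltr0z.
      move=> fc'; rewrite maxEle gtr0_norm//; case: ifP; nra.
    - move=> e; have /andP[u0 u1] := u01 e; rewrite -[u e *~ _]mulrzr.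
      have [f1|f1] := leP 0 ((f e)%:~R : R).
        by rewrite ger0_norm// maxEle; case: ifP; nra.
      by rewrite ltr0_norm// maxEle; case: ifP; nra.
  rewrite ltr_int; lia.
have {fneg} fneg c : f c <= 0.
  by rewrite leNgt; apply/negP => fc; apply: fneg; exists c.
have [c fc] : exists c, f c != 0.
  apply: contrapT => h; move/eqP: f0; apply; apply/zheisP => c; rewrite zheis0.
  by apply/eqP/negPn/negP => fc; apply: h; exists c.
exists (zheis_norm1 f - 1) => u n u01 nE.
have : n%:~R <= 0 :> R.
  rewrite nE -oppr_ge0 -sumrN sumr_ge0// => e _.
  have /andP[u0 u1] := u01 e; rewrite -[u e *~ _]mulrzr.
  have : (f e)%:~R <= 0 :> R by rewrite lerz0.
  nra.
rewrite lerz0 => n0.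
have : (- zheis_norm1 f)%:~R < n%:~R :> R.
  rewrite mulrNz zheis_norm1E nE -subr_gt0 opprK -big_split/=.
  apply: (@sumr_gt0 _ _ c).
  - by rewrite mem_finsupp.
  - have /andP[u0 u1] := u01 c; rewrite -[u c *~ _]mulrzr.
    have : (f c)%:~R < 0 :> R by rewrite ltrz0; move: (fneg c) fc; lia.
    move=> fc'; rewrite ltr0_norm//; nra.
  - move=> e; have /andP[u0 u1] := u01 e; rewrite -[u e *~ _]mulrzr.
    have : (f e)%:~R <= 0 :> R by rewrite lerz0.
    move=> fc'; rewrite ler0_norm//; nra.
rewrite ltr_int; lia.
Qed.

Lemma torus_divisible (d : torus R) n : (0 < n)%N -> exists e, e *+ n = d.
Proof.
move=> n0; have [s [_ <-]] := to_torus_repr d.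
have sE : s / n%:R *+ n = s.
  by rewrite -[_ *+ n]mulr_natr divfK// pnatr_eq0 -lt0n.
by exists (to_torus (s / n%:R)); rewrite -[in RHS]sE raddfMn.
Qed.

Lemma to_torus_centred (t : torus R) :
  exists s : R, `|s| <= 2^-1 /\ to_torus s = t.
Proof.
have [s [/andP[s0 s1] <-]] := to_torus_repr t.
have [h|h] := leP s 2^-1; first by exists s; rewrite ger0_norm.
exists (s - 1); split; first by rewrite ler0_norm; lra.
rewrite raddfB/= (_ : to_torus 1 = 0) ?subr0//; apply/to_torus_eq0.
exact: int_num1.
Qed.

Lemma linf_ballP (v : linfZ) (K : R) :
  (forall c, `|real_of_linfZ R v c| <= K) -> linf_ball K v.
Proof.
move=> vK; apply: ge_sup; first by exists (`|real_of_linfZ R v 1%g|), 1%g.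
by move=> _ [c _ <-].
Qed.

Lemma continuous_ptws (T : topologicalType) (I : Type) (U : topologicalType)
    (h : T -> {ptws I -> U}) :
  (forall i, continuous (fun x => h x i)) -> continuous h.
Proof.
move=> hc x; apply/cvg_sup => i; move: x.
apply/(@continuousP _ (initial_topology (@^~ i))) => A [B ? E].
rewrite -E; have -> : h @^-1` (@^~ i @^-1` B) = (fun x => h x i) @^-1` B by [].
by move/continuousP: (hc i); apply.
Qed.

Lemma xi_continuous (g : zheis) (fsharp : heis -> R) : zheis_central g ->
  ell1 (convol (real_of_zheis R g) fsharp) ->
  continuous (xi g fsharp : linf_weakstar R -> {ptws heis -> torus R}).
Proof.
move=> gc gf1; apply: continuous_ptws => d.
set w := convol (real_of_zheis R g) fsharp in gf1.
(* The weak* pairing of [v] with this translate of [w] is [corr v w d]. *)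
pose W : @ell1 R := SigSub (mem_set (ell1_transl d^-1%g gf1)).
have -> : (fun v => xi g fsharp v d) =
    @to_torus R \o (fun x : {ptws @ell1 R -> R} => x W) \o @weakstar_pairing R.
  by apply/funext => v; rewrite xi_corr.
move=> v; apply: continuous_comp; first exact: initial_continuous.
apply: continuous_comp; first exact: proj_continuous.
exact: pi_continuous.
Qed.

End Bounds.

Theorem theorem5p1 (R : realType) (f g : zheis) (fsharp : heis -> R)
    (f_irreducible : zheis_irreducible f)
    (f_not_invertible : ~ ell1_invertible (real_of_zheis R f))
    (fsharp_inverse : formal_inverse f fsharp)
    (g_central : zheis_central g)
    (g_notin_ideal : ~ exists h : zheis, g = zheis_mul h f)
    (gfsharp_ell1 : ell1 (convol (real_of_zheis R g) fsharp)) :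
  (forall C : set linfZ,
     closed (C : set (linf_uniform R)) -> linf_bounded R C ->
     {within (C : set (linf_weakstar R)),
       continuous (xi g fsharp : linf_weakstar R -> {ptws heis -> torus R})}) /\
  [/\ xi g fsharp @` [set v : linfZ | forall c, 0 <= v c <= zheis_norm1 f - 1]
        = X_ R f,
      xi g fsharp @` linf_ball ((zheis_norm1 f)%:~R / 2 : R) = X_ R f
    & xi g fsharp @` [set: linfZ] = X_ R f].
Proof.
case: fsharp_inverse => _ ffs fsf.
(* Surjectivity of [rho g] on [X_ R f], with [rho g] written out as a pairing. *)
have solve x : X_ R f x -> exists y, X_ R f y /\
    forall d, pairing g (fun c => y (d * c)%g) = x d.
  have g_inj := mul_central_inj_mod f_irreducible g_central g_notin_ideal.
  exact: (pairing_solvable (@torus_divisible R) g_inj).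
have xiX v : X_ R f (xi g fsharp v) by exact: xi_X.
have f0 : f != 0.
  apply/eqP => f0; have := congr1 (@^~ 1%g) ffs.
  rewrite convol_zheisl f0 pairing0l /heis_delta eqxx => /esym/eqP.
  by rewrite oner_eq0.
have digits x : X_ R f x -> exists2 v : linfZ,
    (forall c, 0 <= v c <= zheis_norm1 f - 1) & xi g fsharp v = x.
  (* Lifts in [0, 1) produce integers [n c] that reach the digit range only after adding [k]. So
     [xi] of the constant [k] is subtracted from [x] beforehand, and adding [k] to [n] restores [x]
     by [xiD]. *)
  move=> xX; have [k hk] := digit_shift R f0.
  have kb : bounded_zfun (fun=> k) by exists `|k|.
  pose x' d := x d - xi g fsharp (mk_linfZ kb) d.
  have x'X : X_ R f x'.
    move=> d; rewrite rho_pairing /x' pairingDr.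
    have := xX d; rewrite rho_pairing => ->; rewrite add0r.
    have := xiX (mk_linfZ kb) d; rewrite rho_pairing pairingNr => ->.
    exact: oppr0.
  have [y [yX yx']] := solve _ x'X.
  have [u uP] := choice (fun c => to_torus_repr (y c)).
  have u01 c : 0 <= u c < 1 by have [] := uP c.
  have uy c : to_torus (u c) = y c by have [] := uP c.
  pose n c := Num.floor (pairing f (fun e => u (c * e)%g)).
  have nE c : (n c)%:~R = pairing f (fun e => u (c * e)%g).
    exact: lift_int yX uy.
  have nk c : 0 <= n c + k <= zheis_norm1 f - 1 by exact: hk (nE c).
  have nb : bounded_zfun n.
    by exists (zheis_norm1 f + `|k|) => c; have := nk c; lia.
  have nkb : bounded_zfun (fun c => n c + k).
    by exists (zheis_norm1 f) => c; have := nk c; lia.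
  exists (mk_linfZ nkb); first exact: nk.
  apply/funext => d.
  rewrite (@xiD _ _ _ g_central gfsharp_ell1 (mk_linfZ nb) (mk_linfZ kb))//.
  rewrite (@xi_lift _ f g fsharp g_central fsf gfsharp_ell1 x' y u 1)//.
    by rewrite /x' subrK.
  by move=> c; have /andP[u0 u1] := u01 c; rewrite ger0_norm// ltW.
have centred x : X_ R f x -> exists2 v : linfZ,
    linf_ball ((zheis_norm1 f)%:~R / 2 : R) v & xi g fsharp v = x.
  move=> xX; have [y [yX yx]] := solve _ xX.
  have [u uP] := choice (fun c => to_torus_centred (y c)).
  have u2 c : `|u c| <= 2^-1 by have [] := uP c.
  have uy c : to_torus (u c) = y c by have [] := uP c.
  pose n c := Num.floor (pairing f (fun e => u (c * e)%g)).
  have nE c : (n c)%:~R = pairing f (fun e => u (c * e)%g).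
    exact: lift_int yX uy.
  have nle c : `|(n c)%:~R| <= (zheis_norm1 f)%:~R / 2 :> R.
    by rewrite nE mulrC; apply: pairing_le.
  have nb : bounded_zfun n.
    (* The bound has to be an integer, so half the norm is replaced by the norm, which is
       nonnegative since its half dominates an absolute value. *)
    exists (zheis_norm1 f) => c; rewrite -(ler_int R) intr_norm.
    by apply: le_trans (nle c) _; have := le_trans (normr_ge0 _) (nle c); lra.
  exists (mk_linfZ nb); first exact: linf_ballP.
  exact: (@xi_lift _ f g fsharp g_central fsf gfsharp_ell1 x y u 2^-1).
split=> [C _ _|].
  apply: continuous_subspaceT; exact: xi_continuous.
(* All three images lie in [X_ R f] by [xi_X]; the digit preimages also serve for the whole
   space. *)
split; apply/seteqP; split=> [_ [v _ <-]|x xX]; try exact: xiX.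
- by have [v ? <-] := digits _ xX; exists v.
- by have [v ? <-] := centred _ xX; exists v.
- by have [v ? <-] := digits _ xX; exists v.
Qed.
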